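(* Let $D=\{\rho_1,\dots,\rho_{2k}\}\subseteq\mathbb{Q}$ be a finite domain of $2k$ rational values and let $\mathcal{P}=\{p_1=0,\dots,p_m=0\}$ be a polynomial system over the finite domain $D$ in the variables $x_1,\dots,x_n$. Let $S=V(\mathcal{P})$ be its variety and let $r\in\mathbb{R}[x_1,\dots,x_n]$ be a polynomial nonnegative over $S$. Assume there exists an SoS proof of ''$r\ge 0$'' from $\mathcal{P}$ of degree $2d$, $$r=\sum_{i=1}^{t_0}\sigma_i^2+\sum_{i=1}^m h_ip_i .$$ Let $\mathcal{G}_{2d}$ be a $2d$-truncated Gröbner basis of $I(S)$ with respect to the graded lexicographic order such that $\|\mathcal{G}_{2d}\|_\infty\le 2^{\mathrm{poly}(n^d)}$. Assume that for every $g\in\mathcal{G}_{2d}$ there exists a PC derivation of $g$ (i.e. of ''$g=0$'') from $\mathcal{P}$ of size $\mathrm{poly}(n^d)$ and degree $O(d)$. Then, for every $\varepsilon>0$, the polynomial $r+\varepsilon$ has a degree-$O(d)$ SoS proof from $\mathcal{P}$, $$r+\varepsilon=\sum_{i=1}^{t}\tilde\sigma_i^2+\sum_{i=1}^m\tilde h_ip_i,$$ in which the absolute values of the coefficients of every polynomial appearing in the proof are bounded by $2^{\mathrm{poly}(n^d,\lg\frac1\varepsilon)}$.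
   Context: Polynomials are in $\mathbb{R}[x_1,\dots,x_n]$; $d$ is a fixed degree parameter and asymptotic bounds such as $2^{\mathrm{poly}(n^d)}$, $O(d)$ refer to $n\to\infty$ with $d$ fixed. Standing assumption: the bit complexity of $\mathcal{P}$ and $r$ is polynomial in $n$. For a polynomial $p=\sum_\alpha c_\alpha x^\alpha$, $\|p\|_\infty=\max_\alpha|c_\alpha|$, and for a set of polynomials $\|\mathcal{G}\|_\infty=\max_{g\in\mathcal{G}}\|g\|_\infty$. An SoS proof of ''$r\ge0$'' from $\mathcal{P}=\{p_1=0,\dots,p_m=0\}$ is an identity $r=\sum_i s_i^2+\sum_i h_ip_i$ with $s_i,h_i$ real polynomials; it has degree at most $d$ if $\deg(s_i^2)\le d$ and $\deg(h_ip_i)\le d$ for all $i$. $V(\mathcal{P})$ is the set of common real zeros of $\mathcal{P}$, $I(S)$ is the ideal of polynomials vanishing on $S$, and $I_{d}(S)=I(S)\cap\mathbb{R}[x]_{\le d}$. A polynomial system over the finite domain $D=\{\rho_1,\dots,\rho_{2k}\}$ is a system $\mathcal{P}=\mathcal{F}\cup\mathcal{D}$ where $\mathcal{F}$ is a finite set of polynomial equations and $\mathcal{D}=\{D_{2k}(x_j)=0: j\in[n]\}$ with $D_{2k}(x)=(x-\rho_1)\cdots(x-\rho_{2k})$ (domain polynomials). Polynomial Calculus (PC) derivation rules: from nothing derive any $f=0$ with $f\in\mathcal{P}$, or any $D_{2k}(x_j)=0$; from $f=0$ and $g=0$ derive $af+bg=0$ for $a,b\in\mathbb{R}$; from $f=0$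 derive $x_jf=0$. A PC derivation of ''$r=0$'' is a sequence $(r_1=0,\dots,r_L=0)$ obtained iteratively by these rules with $r_L=r$; its size is the total bit size of the binary encodings of its polynomials, its degree is the maximum degree of its polynomials. The graded lexicographic order (grlex) compares monomials first by total degree, then lexicographically with $x_1>\dots>x_n$. A Gröbner basis $\mathcal{G}$ of an ideal $I$ is a generating set such that $r\in I$ iff the remainder of the multivariate division of $r$ by $\mathcal{G}$ is $0$; its $2d$-truncation is $\mathcal{G}_{2d}=\mathcal{G}\cap\mathbb{R}[x]_{\le 2d}$. *)

(* Defs.v *)
From HB Require Import structures.
From mathcomp Require Import all_boot all_order all_algebra.
From mathcomp Require Import classical_sets reals exp.
From mathcomp Require Import mpoly.
Set Implicit Arguments.
Unset Strict Implicit.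
Unset Printing Implicit Defensive.
Import Order.TTheory GRing.Theory Num.Theory.
Local Open Scope ring_scope.

(* Binary encodings of rational polynomials: a polynomial is the list of its
   monomials, each with its exponent vector and its coefficient (numerator,
   denominator, sign).  The extra bit in [mpoly_bits] makes every polynomial,
   including 0, have positive size. *)
Definition nat_bits (m : nat) : nat := (trunc_log 2 m).+1.

Definition rat_bits (q : rat) : nat :=
  (nat_bits (absz (numq q)) + nat_bits (absz (denq q))).+1.

Definition mnm_bits n (m : 'X_{1..n}) : nat := (\sum_(i < n) nat_bits (m i))%N.

Definition mpoly_bits n (p : {mpoly rat[n]}) : nat :=
  (\sum_(m <- msupp p) (rat_bits p@_m + mnm_bits m))%N.+1.

Section Polynomials.

Variables (R : realType) (n : nat).
Implicit Types (p q r f g : {mpoly R[n]}) (P G L s : seq {mpoly R[n]}).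

(* Only rational polynomials have a binary encoding: a bound on the bit size
   includes the rationality of the coefficients. *)
Definition bitsize_le L (b : nat) : Prop :=
  exists2 Q : seq {mpoly rat[n]},
    L = [seq map_mpoly ratr u | u <- Q] & (\sum_(u <- Q) mpoly_bits u <= b)%N.

Definition deg_le p (D : nat) : bool := (msize p <= D.+1)%N.

Definition mnorm p : R := \big[Num.max/0]_(m <- msupp p) `|p@_m|.

Definition seq_mnorm G : R := \big[Num.max/0]_(g <- G) mnorm g.

Definition domain_poly k (rho : 'I_k -> rat) (j : 'I_n) : {mpoly R[n]} :=
  \prod_(i < k) ('X_j - (ratr (rho i))%:MP).

(* P is of the form F \cup {D(x_1), ..., D(x_n)}. *)
Definition over_domain k (rho : 'I_k -> rat) P : Prop :=
  {subset codom (domain_poly rho) <= P}.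

Definition variety P : set ('I_n -> R) :=
  [set v | forall p, p \in P -> p.@[v] = 0]%classic.

Definition vanishing_ideal (S : set ('I_n -> R)) : set {mpoly R[n]} :=
  [set p | forall v, S v -> p.@[v] = 0]%classic.

Definition lincomb P (h : 'I_(size P) -> {mpoly R[n]}) : {mpoly R[n]} :=
  \sum_(i < size P) h i * P`_i.

(* (s, h) is an SoS proof of r >= 0 from P, of degree at most D. *)
Definition sos_proof P r (D : nat) s (h : 'I_(size P) -> {mpoly R[n]}) : Prop :=
  [/\ r = \sum_(q <- s) q ^+ 2 + lincomb h,
      forall q, q \in s -> deg_le (q ^+ 2) D
    & forall i, deg_le (h i * P`_i) D].

(* The order used by [mlead] compares total degrees first and then, exponent
   of 'X_0 first, the exponent vectors lexicographically (see [mnmc_le]): it is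
   grlex with x_1 > ... > x_n, although the header of the library calls it
   degrevlex. *)
Definition lead_divisors G p : seq {mpoly R[n]} :=
  [seq g <- G | (g != 0) && (mlead g <= mlead p)%MM].

(* Graph of the multivariate division algorithm: [mdiv_rem G p r] means that r
   is the remainder of p in the division by the list G, the first element of G
   whose leading monomial divides that of the current dividend being used. *)
Inductive mdiv_rem G : {mpoly R[n]} -> {mpoly R[n]} -> Prop :=
| mdiv_rem0 : mdiv_rem G 0 0
| mdiv_rem_red p g gs r :
    p != 0 -> lead_divisors G p = g :: gs ->
    mdiv_rem G
      (p - ((mleadc p / mleadc g) *: 'X_[(mlead p - mlead g)%MM]) * g) r ->
    mdiv_rem G p r
| mdiv_rem_skip p r :
    p != 0 -> lead_divisors G p = [::] ->
    mdiv_rem G (p - mleadc p *: 'X_[mlead p]) r ->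
    mdiv_rem G p (r + mleadc p *: 'X_[mlead p]).

Definition grobner_basis (I : set {mpoly R[n]}) G : Prop :=
  [/\ forall g, g \in G -> I g,
      forall f, I f -> exists u : 'I_(size G) -> {mpoly R[n]}, f = lincomb u
    & forall f, I f <-> mdiv_rem G f 0].

Definition mtruncate (D : nat) G : seq {mpoly R[n]} :=
  [seq g <- G | deg_le g D].

Definition pc_step k (rho : 'I_k -> rat) P L r : Prop :=
  [\/ r \in P,
      exists j, r = domain_poly rho j,
      exists f g (a b : R), [/\ f \in L, g \in L & r = a *: f + b *: g]
    | exists f j, f \in L /\ r = 'X_j * f].

Definition pc_derivation k (rho : 'I_k -> rat) P L r : Prop :=
  [/\ forall i, (i < size L)%N -> pc_step rho P (take i L) L`_i,
      (0 < size L)%N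
    & last 0 L = r].

End Polynomials.

Definition lg (R : realType) (x : R) : R := ln x / ln 2.

(* Main.v *)
Require Import Defs.
From HB Require Import structures.
From mathcomp Require Import all_boot all_order all_algebra.
From mathcomp Require Import boolp classical_sets reals exp.
From mathcomp Require Import perm ssrcomplements mpoly.
From mathcomp Require Import ring lra zify.
Set Implicit Arguments.
Unset Strict Implicit.
Unset Printing Implicit Defensive.
Import Order.TTheory GRing.Theory Num.Theory.
Local Open Scope ring_scope.

(** Choose monomials of degree at most d and as many points of S for
    which the matrix of values is invertible, of maximal size.  Its entries are
    rationals of small height, so its determinant is not too small, and every
    polynomial of degree d agrees on S with a combination of the chosen
    monomials whose coefficients are controlled by its values at the chosen
    points.  Replacing each square of the given proof in this way does not
    change the sum of squares on S, where it equals r; this bounds the new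
    squares.  What is left lies in I(S) and has degree 2d, so it is a short sum
    of multiples [u g] of elements of the Groebner basis.  By Berkholz's
    simulation of polynomial calculus, [- g ^+ 2] has a small SoS proof of degree
    O(d), and [u g + eta] is a square plus a multiple of [- (u g) ^+ 2]. *)

(** The given proof may have arbitrarily many squares and arbitrarily large coefficients; only the
    values of [r] on S are controlled. The squares are therefore bounded collectively: at each point
    of S their values add up to [r], whatever their number. The given multipliers are dropped and
    rebuilt from the division of the remaining part by the basis. Three divisions need a lower bound
    on the divisor: by the determinant of values, by the leading coefficient of a basis element, and
    by a minor or coefficient of lines of a derivation. The data being rational, a nonzero divisor
    is at least the inverse of its denominator. The last division arises because the real scalars of
    a linear step are not counted in the bit size of a derivation and have to be replaced by bounded
    ones. The term [eps] pays for working with [- g ^+ 2]: completing the square divides by the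
    constant [eta], which is how [lg (1/eps)] gets into the exponent. The domain enters through
    univariate identities and bounds whose size [kappa] does not depend on [n], so that the degree
    stays O(d). *)

(** * The coefficient norm and degree bounds *)

Section Norm1.
Variables (R : realType) (n : nat).
Implicit Types (p q : {mpoly R[n]}) (m : 'X_{1..n}).

(** Unlike [mnorm], which it dominates, this norm is submultiplicative with no factor counting
    monomials. All estimates use it, up to the last step. *)
Definition norm1 p : R := \sum_(m <- msupp p) `|p@_m|.

Lemma norm1wE p k : (msize p <= k)%N ->
  norm1 p = \sum_(m : 'X_{1..n < k}) `|p@_m|.
Proof.
move=> le_pk; rewrite /norm1 (big_mksub 'X_{1..n < k}) ?msupp_uniq //=.
  by rewrite big_rmcond //= => m /memN_msupp_eq0 ->; rewrite normr0.
by move=> m /msize_mdeg_lt /leq_trans; apply.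
Qed.

Lemma norm1_ge0 p : 0 <= norm1 p.
Proof. exact: sumr_ge0. Qed.

Lemma norm1D p q : norm1 (p + q) <= norm1 p + norm1 q.
Proof.
pose k := maxn (msize p) (msize q).
rewrite (@norm1wE p k) ?leq_maxl // (@norm1wE q k) ?leq_maxr //.
rewrite (@norm1wE _ k) ?msizeD_le // -big_split /=.
by apply: ler_sum => m _; rewrite mcoeffD ler_normD.
Qed.

Lemma norm1N p : norm1 (- p) = norm1 p.
Proof.
rewrite /norm1 (perm_big _ (msuppN p)); apply: eq_bigr => m _.
by rewrite mcoeffN normrN.
Qed.

Lemma norm1B p q : norm1 (p - q) <= norm1 p + norm1 q.
Proof. by rewrite -(norm1N q) norm1D. Qed.

Lemma norm10 : norm1 0 = 0.
Proof. by rewrite /norm1 msupp0 big_nil. Qed.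

Lemma norm1Z c p : norm1 (c *: p) = `|c| * norm1 p.
Proof.
rewrite (@norm1wE _ (msize p)) ?msizeZ_le // (@norm1wE p (msize p)) //.
by rewrite mulr_sumr; apply: eq_bigr => m _; rewrite mcoeffZ normrM.
Qed.

Lemma norm1MX p m : norm1 (p * 'X_[m]) = norm1 p.
Proof.
rewrite /norm1 (perm_big _ (msuppMX p m)) /= big_map.
by apply: eq_bigr => m' _; rewrite mcoeffMX.
Qed.

Lemma norm1_sum I (s : seq I) (P : pred I) (F : I -> {mpoly R[n]}) :
  norm1 (\sum_(i <- s | P i) F i) <= \sum_(i <- s | P i) norm1 (F i).
Proof.
elim/big_rec2: _ => [|i y x _ le_xy]; first by rewrite norm10.
by rewrite (le_trans (norm1D _ _)) // lerD2l.
Qed.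

Lemma norm1M p q : norm1 (p * q) <= norm1 p * norm1 q.
Proof.
rewrite [q in norm1 (p * q)]mpolyE mulr_sumr.
apply: le_trans (norm1_sum _ _ _) _.
rewrite {2}/norm1 mulr_sumr; apply: ler_sum => m _.
by rewrite -scalerAr norm1Z norm1MX mulrC.
Qed.

Lemma norm1X m : norm1 'X_[m] = 1.
Proof. by rewrite /norm1 msuppX big_seq1 mcoeffX eqxx normr1. Qed.

Lemma norm1C c : norm1 c%:MP = `|c|.
Proof. by rewrite -[c%:MP]mulr1 mul_mpolyC norm1Z -mpolyX0 norm1X mulr1. Qed.

Lemma ler_mcoeff_norm1 p m : `|p@_m| <= norm1 p.
Proof.
have [mp|/memN_msupp_eq0->] := boolP (m \in msupp p); last first.
  by rewrite normr0 norm1_ge0.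
by rewrite /norm1 (big_rem m) //= lerDl sumr_ge0.
Qed.

Lemma mnorm_le_norm1 p : mnorm p <= norm1 p.
Proof.
rewrite /mnorm; elim/big_ind: _ => [|x y|m _]; first exact: norm1_ge0.
  by move=> hx hy; rewrite ge_max hx hy.
exact: ler_mcoeff_norm1.
Qed.

Lemma ler_meval_norm1 p (v : 'I_n -> R) (a : R) D : 1 <= a ->
  (forall i, `|v i| <= a) -> deg_le p D -> `|p.@[v]| <= norm1 p * a ^+ D.
Proof.
move=> a1 va dp; rewrite mevalE (le_trans (ler_norm_sum _ _ _)) //.
rewrite /norm1 mulr_suml big_seq [leRHS]big_seq; apply: ler_sum => m mp.
rewrite normrM ler_wpM2l // normr_prod.
have md : (mdeg m <= D)%N by have := msize_mdeg_lt mp; move: dp; rewrite /deg_le; lia.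
apply: le_trans (_ : a ^+ mdeg m <= _); last by rewrite ler_weXn2l.
rewrite mdegE -prodrXr; apply: ler_prod => i _.
by rewrite normr_ge0 normrX lerXn2r // nnegrE (le_trans ler01).
Qed.

Lemma deg_leW p D D' : (D <= D')%N -> deg_le p D -> deg_le p D'.
Proof. by rewrite /deg_le; lia. Qed.

Lemma deg_leD p q D : deg_le p D -> deg_le q D -> deg_le (p + q) D.
Proof. by have := msizeD_le p q; rewrite /deg_le; lia. Qed.

Lemma deg_leN p D : deg_le (- p) D = deg_le p D.
Proof. by rewrite /deg_le msizeN. Qed.

Lemma deg_leB p q D : deg_le p D -> deg_le q D -> deg_le (p - q) D.
Proof. by move=> dp dq; rewrite deg_leD ?deg_leN. Qed.

Lemma deg_le0 D : deg_le (0 : {mpoly R[n]}) D.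
Proof. by rewrite /deg_le msize0. Qed.

Lemma deg_leC c D : deg_le (c%:MP : {mpoly R[n]}) D.
Proof. by rewrite /deg_le msizeC; case: (c == 0). Qed.

Lemma deg_leM p q D D' : deg_le p D -> deg_le q D' -> deg_le (p * q) (D + D').
Proof.
have [->|p0] := eqVneq p 0; first by rewrite mul0r !deg_le0.
have [->|q0] := eqVneq q 0; first by rewrite mulr0 !deg_le0.
rewrite /deg_le msizeM //; move: (msize p) (msize q) => a c. lia.
Qed.

Lemma deg_leMI p q D : q != 0 -> deg_le (p * q) D -> deg_le p D.
Proof.
have [->|p0] := eqVneq p 0; first by rewrite !deg_le0.
move=> q0; rewrite /deg_le msizeM //.
have : (0 < msize q)%N by rewrite lt0n msize_poly_eq0.
by move: (msize p) (msize q) => a c; lia.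
Qed.

Lemma deg_leZ c p D : deg_le p D -> deg_le (c *: p) D.
Proof. by have := msizeZ_le p c; rewrite /deg_le; lia. Qed.

Lemma deg_leX m D : deg_le ('X_[m] : {mpoly R[n]}) D = (mdeg m <= D)%N.
Proof. by rewrite /deg_le msizeX. Qed.

Lemma deg_le_sqr p D : deg_le (p ^+ 2) (2 * D) = deg_le p D.
Proof.
have [->|p0] := eqVneq p 0; first by rewrite expr0n !deg_le0.
rewrite /deg_le expr2 msizeM //.
have : (0 < msize p)%N by rewrite lt0n msize_poly_eq0.
by move: (msize p) => a; lia.
Qed.

Lemma deg_le_sum I (s : seq I) (P : pred I) (F : I -> {mpoly R[n]}) D :
  (forall i, P i -> deg_le (F i) D) -> deg_le (\sum_(i <- s | P i) F i) D.
Proof.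
move=> dF; elim/big_ind: _ => [|p q|i] //; [exact: deg_le0 | exact: deg_leD | exact: dF].
Qed.

End Norm1.

(** * SoS proofs with a coefficient bound, and their calculus *)

Section Certificates.
Variables (R : realType) (n : nat) (P : seq {mpoly R[n]}).
Implicit Types (p q : {mpoly R[n]}) (D : nat) (K : R).

(** The norm of [q] is squared in the bound so that squares and multipliers scale alike when the
    identity is multiplied by a square or a nonnegative scalar. The number of squares is left free,
    so that adding two certificates adds their bounds. *)
Definition certificate D K p : Prop :=
  0 <= K /\ exists s h, [/\ @sos_proof R n P p D s h,
    forall q, q \in s -> norm1 q ^+ 2 <= K & forall i, norm1 (h i) <= K].

Lemma certificate0 D : certificate D 0 0.
Proof.
split=> //; exists [::], (fun=> 0); split=> //; last by move=> i; rewrite norm10.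
split=> // [|i]; last by rewrite mul0r deg_le0.
by rewrite big_nil add0r /lincomb big1 // => i _; rewrite mul0r.
Qed.

Lemma certificateW D D' K K' p : (D <= D')%N -> K <= K' ->
  certificate D K p -> certificate D' K' p.
Proof.
move=> dD dK [K0 [s [h [[-> ds dh] sK hK]]]]; split; first exact: le_trans dK.
exists s, h; split; last by move=> i; exact: le_trans (hK i) dK.
  by split=> // [q /ds|i]; [exact: deg_leW | exact: deg_leW (dh i)].
by move=> q /sK /le_trans; apply.
Qed.

Lemma certificateD D K K' p q :
  certificate D K p -> certificate D K' q -> certificate D (K + K') (p + q).
Proof.
move=> [K0 [s [h [[-> ds dh] sK hK]]]] [K0' [s' [h' [[-> ds' dh'] sK' hK']]]].
split; first exact: addr_ge0.
exists (s ++ s'), (fun i => h i + h' i); split.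
- split=> [|u|i].
  + rewrite big_cat /= addrACA; congr (_ + _); rewrite /lincomb -big_split /=.
    by apply: eq_bigr => i _; rewrite mulrDl.
  + by rewrite mem_cat => /orP[/ds|/ds'].
  + by rewrite mulrDl deg_leD.
- move=> u; rewrite mem_cat => /orP[/sK|/sK'] /le_trans; apply.
    by rewrite lerDl.
  by rewrite lerDr.
- by move=> i; rewrite (le_trans (norm1D _ _)) // lerD.
Qed.

Lemma certificate_sum I (r : seq I) (Q : pred I) D (K : I -> R)
    (F : I -> {mpoly R[n]}) :
  (forall i, Q i -> certificate D (K i) (F i)) ->
  certificate D (\sum_(i <- r | Q i) K i) (\sum_(i <- r | Q i) F i).
Proof.
move=> cF; elim/big_rec2: _ => [|i p K' Qi cp]; first exact: certificate0.
exact: certificateD (cF _ Qi) cp.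
Qed.

Lemma certificateM D D' K p q : deg_le q D' -> certificate D K p ->
  certificate (2 * D' + D) (norm1 q ^+ 2 * K) (q ^+ 2 * p).
Proof.
move=> dq [K0 [s [h [[-> ds dh] sK hK]]]].
have dq2 : deg_le (q ^+ 2) (2 * D') by rewrite deg_le_sqr.
split; first by rewrite mulr_ge0 // exprn_ge0 // norm1_ge0.
exists [seq q * u | u <- s], (fun i => q ^+ 2 * h i); split.
- split=> [|_ /mapP[u us ->]|i].
  + rewrite mulrDr big_map mulr_sumr /lincomb mulr_sumr; congr (_ + _).
      by apply: eq_bigr => u _; rewrite exprMn.
    by apply: eq_bigr => i _; rewrite mulrA.
  + by rewrite exprMn deg_leM ?ds.
  + by rewrite -mulrA deg_leM.
- move=> _ /mapP[u us ->].
  apply: le_trans (_ : (norm1 q * norm1 u) ^+ 2 <= _).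
    by rewrite lerXn2r ?norm1M // nnegrE ?mulr_ge0 ?norm1_ge0.
  by rewrite exprMn ler_wpM2l ?sK // exprn_ge0 ?norm1_ge0.
- move=> i; apply: le_trans (norm1M _ _) _.
  by rewrite ler_pM ?norm1_ge0 // expr2 norm1M.
Qed.

Lemma certificateZ D K p a : 0 <= a -> certificate D K p ->
  certificate D (a * K) (a *: p).
Proof.
move=> a0 /(certificateM (deg_leC n (Num.sqrt a) 0)).
by rewrite norm1C muln0 -normrX -rmorphXn /= sqr_sqrtr // ger0_norm // mul_mpolyC.
Qed.

Lemma certificate_sqr D q : deg_le q D -> certificate (2 * D) (norm1 q ^+ 2) (q ^+ 2).
Proof.
move=> dq; split; first by rewrite exprn_ge0 ?norm1_ge0.
exists [:: q], (fun=> 0); split=> [|u|i]; last by rewrite norm10 exprn_ge0 ?norm1_ge0.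
  split=> [|u|i]; last by rewrite mul0r deg_le0.
    by rewrite big_seq1 /lincomb big1 ?addr0 // => i _; rewrite mul0r.
  by rewrite mem_seq1 => /eqP->; rewrite deg_le_sqr.
by rewrite mem_seq1 => /eqP->.
Qed.

Lemma certificate_const D c : 0 <= c -> certificate D c c%:MP.
Proof.
move=> c0; have := certificate_sqr (deg_leC n (Num.sqrt c) 0).
rewrite norm1C muln0 -normrX -rmorphXn /= sqr_sqrtr // ger0_norm //.
exact: certificateW.
Qed.

Lemma certificate_lincomb D p h : p \in P -> deg_le (h * p) D ->
  certificate D (norm1 h) (h * p).
Proof.
move=> pP dhp; split; first exact: norm1_ge0.
have ip : (index p P < size P)%N by rewrite index_mem.
pose h' (i : 'I_(size P)) := if i == Ordinal ip then h else 0.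
exists [::], h'; split=> // [|i]; last first.
  by rewrite /h'; case: eqP => // _; rewrite norm10 norm1_ge0.
split=> // [|i].
  rewrite big_nil add0r /lincomb (bigD1 (Ordinal ip)) //= /h' eqxx nth_index //.
  by rewrite big1 ?addr0 // => i /negPf ->; rewrite mul0r.
rewrite /h'; case: eqP => [->|_]; last by rewrite mul0r deg_le0.
by rewrite /= nth_index.
Qed.

End Certificates.

(** * Bit size, coefficient size and denominators *)

Lemma ltn_nat_bits a : (a < 2 ^ nat_bits a)%N.
Proof. exact: trunc_log_ltn. Qed.

(** The additional 1 in the exponent matches the extra bit in [mpoly_bits]; positivity of the
    exponents lets a product of powers dominate their sum. *)
Lemma sum_exp2_lt I (s : seq I) (a : I -> nat) : (forall i, (0 < a i)%N) ->
  (\sum_(i <- s) 2 ^ a i < 2 ^ (\sum_(i <- s) a i).+1)%N.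
Proof.
move=> a0; elim: s => [|i s IHs]; first by rewrite !big_nil.
rewrite !big_cons -[(a i + _).+1]addnS expnD.
have : (2 ^ 1 <= 2 ^ a i)%N by rewrite leq_exp2l.
have : (2 ^ 1 <= 2 ^ (\sum_(i <- s) a i).+1)%N by rewrite leq_exp2l.
by nia.
Qed.

Section BitSize.
Variable R : realType.

(** This form of rationality lives inside [R] and serves for lower bounds: a nonzero [x] satisfies
    [1 <= |x| * 2 ^+ X], since a nonzero integer has absolute value at least 1. *)
Definition bounded_den (X : nat) (x : R) : Prop :=
  exists2 D : nat, (0 < D <= 2 ^ X)%N & x * D%:R \is a Num.int.

Lemma bounded_denM X Y x y : bounded_den X x -> bounded_den Y y ->
  bounded_den (X + Y) (x * y).
Proof.
move=> [D /andP[D0 DX] xD] [D' /andP[D0' DY] yD]; exists (D * D')%N.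
  by rewrite muln_gt0 D0 D0' expnD leq_mul.
by rewrite natrM mulrACA rpredM.
Qed.

Lemma bounded_denB X Y x y : bounded_den X x -> bounded_den Y y ->
  bounded_den (X + Y) (x - y).
Proof.
move=> [D /andP[D0 DX] xD] [D' /andP[D0' DY] yD]; exists (D * D')%N.
  by rewrite muln_gt0 D0 D0' expnD leq_mul.
have -> : (x - y) * (D * D')%:R = x * D%:R * D'%:R - y * D'%:R * D%:R.
  by rewrite natrM; ring.
by rewrite rpredB // rpredM // natr_int.
Qed.

Lemma bounded_den_ge X x : x != 0 -> bounded_den X x -> 1 <= `|x| * 2 ^+ X.
Proof.
move=> x0 [D /andP[D0 DX] xD].
have DR : (0 : R) < D%:R by rewrite ltr0n.
have : 1 <= `|x * D%:R| by rewrite norm_intr_ge1 // mulf_neq0 // gt_eqF.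
rewrite normrM [`|D%:R|]ger0_norm ?(ltW DR) // => /le_trans; apply.
by rewrite ler_wpM2l // -natrX ler_nat.
Qed.

Lemma bounded_den_ratr (q : rat) X : (rat_bits q <= X)%N -> bounded_den X (ratr q).
Proof.
move=> qX; exists (absz (denq q)).
  rewrite absz_gt0 denq_eq0 /=.
  apply: leq_trans (ltnW (ltn_nat_bits _)) _.
  by rewrite leq_exp2l // (leq_trans _ qX) // /rat_bits ltnW // ltnS leq_addl.
rewrite -[(absz _)%:R]/((absz (denq q))%:Z%:~R) absz_denq.
by rewrite /ratr divfK ?intr_int // intr_eq0 denq_eq0.
Qed.

Lemma norm_ratr_le (q : rat) : `|ratr q : R| <= (2 ^ rat_bits q)%:R.
Proof.
have d1 : (1 : R) <= (denq q)%:~R by rewrite ler1z -gtz0_ge1 denq_gt0.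
rewrite /ratr normrM normfV [`|(denq q)%:~R|]ger0_norm ?(le_trans ler01) //.
rewrite ler_pdivrMr ?(lt_le_trans ltr01) //.
apply: le_trans (_ : (absz (numq q))%:R <= _).
  by rewrite -intr_norm -abszE.
apply: le_trans (_ : (2 ^ rat_bits q)%:R * 1 <= _); last by rewrite ler_wpM2l.
rewrite mulr1 ler_nat (leq_trans (ltnW (ltn_nat_bits _))) //.
by rewrite leq_exp2l // /rat_bits ltnW // ltnS leq_addr.
Qed.

Variable n : nat.
Implicit Types (L : seq {mpoly R[n]}).

Lemma rat_bits_le_mpoly_bits (u : {mpoly rat[n]}) m :
  m \in msupp u -> (rat_bits u@_m <= mpoly_bits u)%N.
Proof.
by move=> mu; rewrite /mpoly_bits (big_rem m) //= -addnA ltnW // ltnS leq_addr.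
Qed.

Lemma norm1_map_ratr (u : {mpoly rat[n]}) :
  norm1 (map_mpoly ratr u : {mpoly R[n]}) <= 2 ^+ mpoly_bits u.
Proof.
rewrite /norm1 (perm_big _ (msupp_map_mpoly u (fmorph_inj _))) /=.
apply: le_trans (_ : (\sum_(m <- msupp u) 2 ^ (rat_bits u@_m + mnm_bits m))%:R <= _).
  rewrite natr_sum; apply: ler_sum => m _; rewrite mcoeff_map_mpoly.
  apply: le_trans (norm_ratr_le _) _.
  by rewrite ler_nat leq_exp2l ?leq_addr.
by rewrite -natrX ler_nat; apply/ltnW/sum_exp2_lt.
Qed.

Lemma bitsize_leW L X Y : (X <= Y)%N -> bitsize_le L X -> bitsize_le L Y.
Proof. by move=> XY [Q -> QX]; exists Q => //; exact: leq_trans XY. Qed.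

Lemma size_bitsize_le L X : bitsize_le L X -> (size L <= X)%N.
Proof.
move=> [Q -> QX]; rewrite size_map (leq_trans _ QX) // -sum1_size.
exact: leq_sum.
Qed.

Lemma norm1_bitsize_le L X p : bitsize_le L X -> p \in L -> norm1 p <= 2 ^+ X.
Proof.
move=> [Q -> QX] /mapP[u uQ ->]; apply: le_trans (norm1_map_ratr u) _.
rewrite ler_eXn2l ?ltr1n // (leq_trans _ QX) //.
by rewrite (big_rem u) //= leq_addr.
Qed.

Lemma bounded_den_bitsize_le L X p m :
  bitsize_le L X -> p \in L -> bounded_den X p@_m.
Proof.
move=> [Q -> QX] /mapP[u uQ ->]; rewrite mcoeff_map_mpoly.
have [mu|/memN_msupp_eq0 ->] := boolP (m \in msupp u); last first.
  by exists 1%N; rewrite ?expn_gt0 ?raddf0 ?mul0r ?rpred0 //.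
apply: bounded_den_ratr; apply: leq_trans (rat_bits_le_mpoly_bits mu) _.
by rewrite (leq_trans _ QX) // (big_rem u) //= leq_addr.
Qed.

End BitSize.

(** * Bounded scalars for a linear step of a derivation *)

Section LinearStep.
Variables (R : realType) (n : nat).

(* Cramer's rule on two monomials where [f] and [g] have a nonzero minor; all
   minors vanish only if [f] and [g] are proportional. *)
Lemma bounded_lin_comb (X : nat) (f g h : {mpoly R[n]}) (a b : R) :
  (forall m, bounded_den X f@_m) -> (forall m, bounded_den X g@_m) ->
  norm1 f <= 2 ^+ X -> norm1 g <= 2 ^+ X -> norm1 h <= 2 ^+ X ->
  h = a *: f + b *: g ->
  exists a' b', [/\ h = a' *: f + b' *: g,
    `|a'| <= 2 ^+ (6 * X + 1) & `|b'| <= 2 ^+ (6 * X + 1)].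
Proof.
move=> fX gX f2 g2 h2 hE.
have fm m := le_trans (ler_mcoeff_norm1 f m) f2.
have gm m := le_trans (ler_mcoeff_norm1 g m) g2.
have hm m := le_trans (ler_mcoeff_norm1 h m) h2.
have hmE m : h@_m = a * f@_m + b * g@_m by rewrite hE mcoeffD !mcoeffZ.
have big0 : (0 : R) <= 2 ^+ (6 * X + 1) by rewrite exprn_ge0.
have single (c u v : R) : u != 0 -> bounded_den X u -> `|v| <= 2 ^+ X ->
    v = c * u -> `|c| <= 2 ^+ (6 * X + 1).
  move=> u0 uX vX vE.
  apply: le_trans (_ : `|c| * (`|u| * 2 ^+ X) <= _).
    by rewrite ler_peMr // bounded_den_ge.
  rewrite mulrA -normrM -vE.
  apply: le_trans (_ : 2 ^+ X * 2 ^+ X <= _); first by rewrite ler_wpM2r ?exprn_ge0.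
  by rewrite -exprD ler_eXn2l ?ltr1n //; lia.
have [[m [m' d0]]|noM] :=
    EM (exists m m', f@_m * g@_m' - f@_m' * g@_m != 0).
  exists a, b; set d := _ - _ in d0.
  (* Each product of two entries has denominator at most [2 ^ (2 * X)], hence [4 * X] for the minor.
     The numerators in Cramer's rule are at most [2 ^ (2 * X + 1)]; together this gives
     [6 * X + 1]. *)
  have dX : 1 <= `|d| * 2 ^+ ((X + X) + (X + X)).
    by apply: bounded_den_ge => //; apply: bounded_denB; apply: bounded_denM.
  have two (u v w z : R) : `|u| <= 2 ^+ X -> `|v| <= 2 ^+ X -> `|w| <= 2 ^+ X ->
      `|z| <= 2 ^+ X -> `|u * v - w * z| <= 2 ^+ (2 * X + 1).
    move=> u2 v2 w2 z2; apply: le_trans (ler_normB _ _) _; rewrite !normrM.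
    apply: le_trans (lerD (ler_pM _ _ u2 v2) (ler_pM _ _ w2 z2)) _ => //.
    have -> : (2 * X + 1 = (X + X).+1)%N by rewrite addn1 mul2n addnn.
    by rewrite exprS exprD mulr_natl mulr2n.
  have minor c : `|c * d| <= 2 ^+ (2 * X + 1) -> `|c| <= 2 ^+ (6 * X + 1).
    move=> cd; apply: le_trans (_ : `|c| * (`|d| * 2 ^+ ((X + X) + (X + X))) <= _).
      by rewrite ler_peMr.
    rewrite mulrA -normrM.
    apply: le_trans (ler_wpM2r _ cd) _; first by rewrite exprn_ge0.
    by rewrite -exprD ler_eXn2l ?ltr1n //; lia.
  split=> //; apply: minor.
    have -> : a * d = h@_m * g@_m' - h@_m' * g@_m by rewrite !hmE /d; ring.
    exact: two.
  have -> : b * d = f@_m * h@_m' - f@_m' * h@_m by rewrite !hmE /d; ring.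
  exact: two.
have {}noM m m' : f@_m * g@_m' = f@_m' * g@_m.
  by apply/eqP; rewrite -subr_eq0; apply/negPn/negP => d0; apply: noM; exists m, m'.
have [f0|f0] := eqVneq f 0; last first.
  have l0 : mleadc f != 0 by rewrite mleadc_eq0.
  (* Here [g], and so [h], is a multiple of [f]; the ratio is read at one monomial. *)
  pose c := h@_(mlead f) / mleadc f.
  have cE : h@_(mlead f) = c * mleadc f by rewrite /c divfK.
  exists c, 0; split; [|exact: single cE|by rewrite normr0].
  apply/mpolyP => m; rewrite scale0r addr0 mcoeffZ.
  apply: (mulIf l0); rewrite mulrAC -cE !hmE.
  have := noM m (mlead f); move: (f@_m) (g@_m) (f@_(mlead f)) (g@_(mlead f)).
  by move=> u v w z uz; rewrite !mulrDl -!mulrA [v * w]mulrC -uz; ring.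
have [g0|g0] := eqVneq g 0.
  exists 0, 0; split; rewrite ?normr0 //.
  by rewrite hE f0 g0 !scaler0.
have l0 : mleadc g != 0 by rewrite mleadc_eq0.
exists 0, b; split; rewrite ?normr0 //; first by rewrite hE f0 !scaler0.
by apply: (single _ (mleadc g) h@_(mlead g)) => //; rewrite hmE f0 mcoeff0 mulr0 add0r.
Qed.

End LinearStep.

(** * A univariate SoS identity on the domain *)

Section Univariate.
Variable R : realType.

Lemma poly_interpolation (xs : seq R) (y : R -> R) : uniq xs ->
  exists p : {poly R}, forall x, x \in xs -> p.[x] = y x.
Proof.
elim: xs => [|x xs IHxs] /=; first by exists 0.
move=> /andP[xNxs /IHxs[p pE]].
pose w := \prod_(z <- xs) ('X - z%:P).
have wx0 : w.[x] != 0 by rewrite -[_ == 0]/(root w x) root_prod_XsubC.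
exists (p + ((y x - p.[x]) / w.[x]) *: w) => z; rewrite inE hornerD hornerZ.
have [-> _|_ /= zxs] := eqVneq z x; first by rewrite divfK // addrC subrK.
have /rootP -> : root w z by rewrite root_prod_XsubC.
by rewrite mulr0 addr0 pE.
Qed.

Definition domain_upoly q (rho : 'I_q -> rat) : {poly R} :=
  \prod_(i < q) ('X - (ratr (rho i))%:P).

(** Let [s] interpolate the square root of [c^2 - x^2] at the domain values. Then [c^2 - x^2 - s^2]
    vanishes at these distinct points, so the domain polynomial divides it. *)
Lemma sqr_bound_certificate q (rho : 'I_q -> rat) (c : R) :
  injective rho -> (forall i, `|ratr (rho i)| <= c) ->
  exists s g : {poly R}, (c ^+ 2)%:P - 'X^2 = s ^+ 2 + g * domain_upoly rho.
Proof.
move=> rho_inj rho_c; pose xs : seq R := [seq ratr (rho i) | i <- enum 'I_q].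
have uxs : uniq xs.
  by rewrite map_inj_uniq ?enum_uniq // => i j /fmorph_inj/rho_inj.
have [s sE] := poly_interpolation (fun x => Num.sqrt (c ^+ 2 - x ^+ 2)) uxs.
have : \prod_(x <- xs) ('X - x%:P) %| (c ^+ 2)%:P - 'X^2 - s ^+ 2.
  apply: uniq_roots_dvdp; last by rewrite uniq_rootsE.
  apply/allP => x xxs; rewrite /root !hornerE sE //.
  rewrite sqr_sqrtr ?subrr // subr_ge0.
  by have /mapP[i _ ->] := xxs; rewrite -real_normK ?num_real // lerXn2r ?nnegrE ?(le_trans _ (rho_c i)).
move=> /dvdpP[g gE]; exists s, g.
have -> : domain_upoly rho = \prod_(x <- xs) ('X - x%:P) by rewrite big_map big_enum.
by rewrite -gE [RHS]addrC subrK.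
Qed.

Variable n : nat.

Definition of_upoly (j : 'I_n) (p : {poly R}) : {mpoly R[n]} := horner_alg 'X_j p.

Lemma of_upolyE j p : of_upoly j p = \sum_(i < size p) p`_i *: 'X_j ^+ i.
Proof.
have {1}-> : p = \sum_(i < size p) p`_i *: 'X^i by rewrite -poly_def coefK.
rewrite /of_upoly rmorph_sum /=.
by apply: eq_bigr => i _; rewrite linearZ /= rmorphXn /= horner_algX mulr_algl.
Qed.

Lemma deg_le_of_upoly j p : deg_le (of_upoly j p) (size p).
Proof.
rewrite of_upolyE; apply: deg_le_sum => i _.
by rewrite deg_leZ // mpolyXn deg_leX mdegMn mdeg1 mul1n ltnW.
Qed.

Lemma norm1_of_upoly j p : norm1 (of_upoly j p) <= \sum_(i < size p) `|p`_i|.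
Proof.
rewrite of_upolyE (le_trans (norm1_sum _ _ _)) //.
by apply: ler_sum => i _; rewrite norm1Z mpolyXn norm1X mulr1.
Qed.

Lemma of_upoly_domain q (rho : 'I_q -> rat) j :
  of_upoly j (domain_upoly rho) = domain_poly R rho j.
Proof.
rewrite /of_upoly rmorph_prod /=; apply: eq_bigr => i _.
by rewrite rmorphB /= horner_algX horner_algC -[_%:A]mul_mpolyC mulr1.
Qed.

End Univariate.

(** * Simulation of polynomial calculus by SoS proofs *)

Section PolynomialCalculus.
Variables (R : realType) (n q : nat) (rho : 'I_q -> rat).
Implicit Types (P L : seq {mpoly R[n]}).

(** One [kappa] bounds both the coefficients (as an exponent of 2) and the degrees of the univariate
    identity, which is reused for every variable. *)
Definition sqr_bounded_by (kappa : nat) : Prop :=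
  exists (c : R) (s g : {poly R}),
    [/\ (c ^+ 2)%:P - 'X^2 = s ^+ 2 + g * domain_upoly R rho,
        c ^+ 2 <= 2 ^+ kappa /\ (\sum_(i < size s) `|s`_i|) ^+ 2 <= 2 ^+ kappa,
        \sum_(i < size g) `|g`_i| <= 2 ^+ kappa
      & (size s <= kappa /\ size g + size (domain_upoly R rho) <= 2 * kappa)%N].

(** Write [- x^2 f^2 = (c^2 - x^2) f^2 + c^2 (- f^2)] and expand the first factor by the univariate
    identity. Its terms have degree at most [2 * D + 2 * kappa] by the degree of [f] alone, so the
    degree of the certificate does not grow. *)
Lemma certificate_mulX P kappa D A K (f : {mpoly R[n]}) j :
  sqr_bounded_by kappa -> over_domain rho P -> deg_le f D -> norm1 f <= A ->
  certificate P (2 * D + 2 * kappa) K (- f ^+ 2) ->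
  certificate P (2 * D + 2 * kappa) (2 ^+ kappa * (2 * A ^+ 2 + K))
    (- ('X_j * f) ^+ 2).
Proof.
move=> [c [s [g [e [c2 s2] g2 [ss sg]]]]] dP df fA cf.
have K0 : 0 <= K by case: cf.
have A2 : norm1 f ^+ 2 <= A ^+ 2.
  by rewrite lerXn2r // nnegrE (le_trans (norm1_ge0 f)).
have de := deg_le_of_upoly.
have eX : (c ^+ 2)%:MP - 'X_j ^+ 2 =
    of_upoly j s ^+ 2 + of_upoly j g * domain_poly R rho j.
  rewrite -of_upoly_domain /of_upoly.
  have := congr1 (horner_alg 'X_j) e.
  rewrite rmorphB rmorphD /= horner_algC (rmorphM _ g) (rmorphXn _ 2 'X) (rmorphXn _ 2 s) /=.
  by rewrite horner_algX -[_%:A]mul_mpolyC mulr1.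
have -> : - ('X_j * f) ^+ 2 = (of_upoly j s * f) ^+ 2 +
    (of_upoly j g * f ^+ 2) * domain_poly R rho j + c ^+ 2 *: (- f ^+ 2).
  rewrite -mul_mpolyC; have -> : 'X_j * f = f * 'X_j by rewrite mulrC.
  have {}eX : - 'X_j ^+ 2 = of_upoly j s ^+ 2 +
    of_upoly j g * domain_poly R rho j - (c ^+ 2)%:MP by rewrite -eX; ring.
  have -> : - (f * 'X_j) ^+ 2 = - 'X_j ^+ 2 * f ^+ 2 by ring.
  by rewrite eX; ring.
have h1 : certificate P (2 * D + 2 * kappa)
    (norm1 (of_upoly j s * f) ^+ 2) ((of_upoly j s * f) ^+ 2).
  apply: certificateW (certificate_sqr P (deg_leM (de _ _ j s) df)) => //.
  by rewrite mulnDr addnC leq_add2l leq_mul2l ss.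
have h2 : certificate P (2 * D + 2 * kappa) (norm1 (of_upoly j g * f ^+ 2))
    (of_upoly j g * f ^+ 2 * domain_poly R rho j).
  apply: certificate_lincomb; first by apply: dP; apply: codom_f.
  have d1 : deg_le (of_upoly j g * f ^+ 2) (size g + 2 * D).
    by apply: deg_leM => //; rewrite deg_le_sqr.
  have := de R n j (domain_upoly R rho); rewrite of_upoly_domain => d2.
  by apply: deg_leW (deg_leM d1 d2); rewrite addnAC addnC leq_add2l.
have h3 := certificateZ (sqr_ge0 c) cf.
apply: certificateW (certificateD (certificateD h1 h2) h3) => //.
rewrite mulrDr [2 * A ^+ 2]mulr_natl mulr2n mulrDr; apply: lerD; last by rewrite ler_wpM2r.
apply: lerD.
  apply: le_trans (_ : (norm1 (of_upoly j s) * norm1 f) ^+ 2 <= _).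
    by rewrite lerXn2r ?norm1M // nnegrE ?mulr_ge0 ?norm1_ge0.
  rewrite exprMn; apply: ler_pM; rewrite ?exprn_ge0 ?norm1_ge0 //.
  apply: le_trans s2; rewrite lerXn2r ?norm1_of_upoly // nnegrE ?norm1_ge0 //.
  exact: sumr_ge0.
apply: le_trans (norm1M _ _) _; apply: ler_pM; rewrite ?norm1_ge0 //.
  exact: le_trans (norm1_of_upoly _ _) g2.
by apply: le_trans A2; rewrite expr2 norm1M.
Qed.

(* [af + bg] squared is [2a^2 f^2 + 2b^2 g^2 - (af - bg)^2]. *)
Lemma certificate_lin P D D' A B K (f g : {mpoly R[n]}) a b :
  deg_le f D -> deg_le g D -> norm1 f <= A -> norm1 g <= A ->
  `|a| <= B -> `|b| <= B -> (2 * D <= D')%N ->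
  certificate P D' K (- f ^+ 2) -> certificate P D' K (- g ^+ 2) ->
  certificate P D' (4 * B ^+ 2 * (A ^+ 2 + K)) (- (a *: f + b *: g) ^+ 2).
Proof.
move=> df dg fA gA aB bB dD cf cg.
have K0 : 0 <= K by case: cf.
have A0 := le_trans (norm1_ge0 f) fA.
have B0 := le_trans (normr_ge0 a) aB.
have sq (c : R) : `|c| <= B -> 2 * c ^+ 2 * K <= 2 * B ^+ 2 * K.
  move=> cB; rewrite ler_wpM2r // ler_wpM2l // -real_normK ?num_real //.
  by rewrite lerXn2r // nnegrE.
have -> : - (a *: f + b *: g) ^+ 2 = (a *: f - b *: g) ^+ 2 +
    ((2 * a ^+ 2) *: (- f ^+ 2) + (2 * b ^+ 2) *: (- g ^+ 2)).
  rewrite -!mul_mpolyC !mpolyCM rmorph_nat; ring.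
have h1 := certificate_sqr P (deg_leB (deg_leZ a df) (deg_leZ b dg)).
have p2 (c : R) : 0 <= 2 * c ^+ 2 by rewrite mulr_ge0 // sqr_ge0.
apply: certificateW (certificateD (certificateW dD (lexx _) h1)
  (certificateD (certificateZ (p2 a) cf) (certificateZ (p2 b) cg))) => //.
apply: le_trans (lerD _ (lerD (sq _ aB) (sq _ bB))) _; last first.
  apply: (_ : (B * A + B * A) ^+ 2 + _ <= _); lra.
rewrite lerXn2r ?nnegrE ?norm1_ge0 ?addr_ge0 ?mulr_ge0 //.
apply: le_trans (norm1B _ _) _; rewrite !norm1Z.
by apply: lerD; apply: ler_pM; rewrite ?normr_ge0 ?norm1_ge0.
Qed.

(* Berkholz's simulation: -f^2 rather than f is certified for every line f, so
   that the degree does not grow along the derivation. *)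
Lemma pc_certificate P L kappa D X :
  sqr_bounded_by kappa -> over_domain rho P -> bitsize_le L X ->
  (forall f, f \in L -> deg_le f D) ->
  (forall i, (i < size L)%N -> pc_step rho P (take i L) L`_i) ->
  forall i, (i < size L)%N -> certificate P (2 * D + 2 * kappa)
    ((2 ^+ (14 * X + kappa + 5)) ^+ i.+1) (- L`_i ^+ 2).
Proof.
move=> hk dP LX dL steps i; have [k] := ubnP i.
elim: k i => // k IHk i ik iL.
(* The cost of one line. A linear step costs [4 B^2 (A^2 + K)] with [B = 2^(6X+1)] and [A = 2^X],
   hence at most a factor [2^(14X+5)]; a multiplication by a variable costs at most
   [2^(kappa+2+2X)]. *)
set Z := 2 ^+ (14 * X + kappa + 5).
have Z1 : 1 <= Z by rewrite exprn_ege1 ?ler1n.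
have Z0 : 0 <= Z := le_trans ler01 Z1.
have Li0 := mem_nth 0 iL.
have N1 f : f \in L -> norm1 f <= 2 ^+ X by apply: norm1_bitsize_le.
have prev f : f \in take i L ->
    certificate P (2 * D + 2 * kappa) (Z ^+ i) (- f ^+ 2) /\ f \in L.
  move=> fL; split; last exact: mem_take fL.
  pose j := index f (take i L).
  have ji : (j < i)%N.
    by rewrite -[i in (_ < i)%N](size_takel (ltnW iL)) index_mem.
  have -> : f = L`_j by rewrite -(nth_take 0 ji) nth_index.
  apply: certificateW (IHk j _ _) => //; [|lia|exact: ltn_trans iL].
  by rewrite ler_weXn2l.
have ax : L`_i \in P -> certificate P (2 * D + 2 * kappa) (Z ^+ i.+1) (- L`_i ^+ 2).
  move=> LP; have -> : - L`_i ^+ 2 = - L`_i * L`_i by ring.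
  apply: certificateW (leqnn _) _ (certificate_lincomb LP _).
    rewrite norm1N (le_trans (N1 _ Li0)) //.
    apply: le_trans (_ : Z <= _); last by rewrite [leRHS]exprS ler_peMr // exprn_ege1.
    by rewrite ler_eXn2l ?ltr1n //; lia.
  have d1 : deg_le (- L`_i) D by rewrite deg_leN dL.
  by apply: deg_leW (deg_leM d1 (dL _ Li0)); lia.
have Zi1 : 1 <= Z ^+ i by rewrite exprn_ege1.
case: (steps i iL) => [|[j Lj]|[f [g [a [b [fL gL Le]]]]]|[f [j [fL ->]]]].
- exact: ax.
- by apply: ax; rewrite Lj; apply: dP; apply: codom_f.
- have [cf fL'] := prev f fL; have [cg gL'] := prev g gL.
  have [a' [b' [-> a2 b2]]] := bounded_lin_comb
    (fun m => bounded_den_bitsize_le m LX fL') (fun m => bounded_den_bitsize_le m LX gL')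
    (N1 _ fL') (N1 _ gL') (N1 _ Li0) Le.
  have cl := certificate_lin (dL _ fL') (dL _ gL') (N1 _ fL') (N1 _ gL') a2 b2
    (leq_addr _ _) cf cg.
  apply: certificateW (leqnn _) _ cl.
  rewrite [leRHS]exprS -[(2 ^+ X) ^+ 2]exprM -?[(2 ^+ (6 * X + 1)) ^+ 2]exprM.
  apply: le_trans (_ : 4 * 2 ^+ ((6 * X + 1) * 2) * (2 * 2 ^+ (X * 2) * Z ^+ i) <= _).
    have X1 : (1 : R) <= 2 ^+ (X * 2) by rewrite exprn_ege1 ?ler1n.
    by rewrite ler_wpM2l ?mulr_ge0 ?exprn_ge0 //; nra.
  rewrite mulrA ler_wpM2r ?exprn_ge0 //.
  have -> : (4 : R) = 2 ^+ 2 by rewrite expr2; ring.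
  by rewrite -exprS -!exprD ler_eXn2l ?ltr1n //; clear; lia.
- have [cf fL'] := prev f fL.
  have cX := certificate_mulX j hk dP (dL _ fL') (N1 _ fL') cf.
  apply: certificateW (leqnn _) _ cX.
  rewrite [leRHS]exprS -[(2 ^+ X) ^+ 2]exprM -?[(2 ^+ (6 * X + 1)) ^+ 2]exprM.
  apply: le_trans (_ : 2 ^+ kappa * (2 ^+ 2 * 2 ^+ (X * 2) * Z ^+ i) <= _).
    have X1 : (1 : R) <= 2 ^+ (X * 2) by rewrite exprn_ege1 ?ler1n.
    by rewrite ler_wpM2l ?exprn_ge0 // expr2; nra.
  rewrite mulrA ler_wpM2r ?exprn_ge0 //.
  by rewrite -!exprD ler_eXn2l ?ltr1n //; lia.
Qed.

End PolynomialCalculus.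

(** * Counting monomials *)

Section MonomialCount.
Variable n : nat.

(** A monomial of degree at most [D] is spelled by a word of length exactly [D] over the variables
    and a blank [None], an alphabet of [n.+1] letters. *)
Lemma mnm_sum_units D (m : 'X_{1..n}) : (mdeg m <= D)%N ->
  exists2 s : seq (option 'I_n), size s = D &
    m = (\sum_(o <- s) if o is Some i then U_(i) else 0)%MM.
Proof.
elim: D m => [|D IHD] m mD.
  by exists [::]; rewrite ?big_nil //; apply/eqP; rewrite -mdeg_eq0 -leqn0.
have [/eqP|m0] := eqVneq (mdeg m) 0%N.
  rewrite mdeg_eq0 => /eqP ->; exists (nseq D.+1 None); first by rewrite size_nseq.
  by rewrite big_nseq iter_fix // addm0.
have [i mi] : exists i, m i != 0%N.
  apply/existsP; apply: contraNT m0 => /existsPn m0.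
  by rewrite mdegE big1 // => i _; apply/eqP; have := m0 i; rewrite negbK.
have Um : (U_(i) <= m)%MM by rewrite lep1mP.
have mE : m = (U_(i) + (m - U_(i)))%MM by rewrite addmC submK.
have [|s sD sE] := IHD (m - U_(i))%MM.
  by move: mD; rewrite {1}mE mdegD mdeg1.
by exists (Some i :: s); rewrite /= ?sD // big_cons -sE.
Qed.

Lemma card_bmultinom_le D : (#|{: 'X_{1..n < D.+1}}| <= n.+1 ^ D)%N.
Proof.
pose F (w : D.-tuple (option 'I_n)) : 'X_{1..n < D.+1} :=
  insubd bm0 (\sum_(o <- w) if o is Some i then U_(i) else 0)%MM.
have -> : (n.+1 ^ D)%N = #|{: D.-tuple (option 'I_n)}|.
  by rewrite card_tuple card_option card_ord.
rewrite (leq_trans _ (leq_image_card F predT)) //.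
apply/subset_leq_card/fintype.subsetP => m _.
have /mnm_sum_units[s sD sE] : (mdeg m <= D)%N by rewrite -ltnS bmdeg.
have sD' : size s == D by apply/eqP.
by apply/codomP; exists (Tuple sD'); apply: val_inj; rewrite val_insubd /= -sE bmdeg.
Qed.

End MonomialCount.

(** * Determinants and inverses of rational matrices *)

Section Determinants.
Variable R : realType.

Lemma norm_det_le r (A : 'M[R]_r) (x : R) :
  (forall i j, `|A i j| <= x) -> `|\det A| <= r`!%:R * x ^+ r.
Proof.
move=> Ax; apply: le_trans (ler_norm_sum _ _ _) _.
apply: le_trans (_ : \sum_(s : 'S_r) x ^+ r <= _); last first.
  by rewrite sumr_const card_Sn mulr_natl.
apply: ler_sum => s _; rewrite normrM normrX normrN1 expr1n mul1r normr_prod.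
rewrite -[r in x ^+ r]card_ord -prodr_const; apply: ler_prod => i _.
by rewrite normr_ge0 Ax.
Qed.

(** The matrix scaled by [D] is integral, so its nonzero determinant, [D ^ r] times that of [A], is
    at least 1 in absolute value. *)
Lemma norm_det_ge1 r (A : 'M[R]_r) (D : nat) : \det A != 0 -> (0 < D)%N ->
  (forall i j, A i j * D%:R \is a Num.int) -> 1 <= `|\det A| * D%:R ^+ r.
Proof.
move=> dA D0 AD.
have e : D%:R ^+ r * \det A = \det (D%:R *: A) by rewrite detZ.
have : 1 <= `|\det (D%:R *: A)|.
  rewrite norm_intr_ge1 //; last first.
    by rewrite -e mulf_neq0 // expf_neq0 // pnatr_eq0 -lt0n.
  rewrite /determinant rpred_sum // => s _; rewrite rpredM ?rpredX ?rpredN ?rpred1 //.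
  by rewrite rpred_prod // => i _; rewrite mxE mulrC.
by rewrite -e mulrC normrM [`|D%:R ^+ r|]ger0_norm // exprn_ge0.
Qed.

(** Entries of the inverse are cofactors over the determinant: the former are bounded above by the
    Leibniz formula, the latter below by integrality. *)
Lemma norm_invmx_le r (A : 'M[R]_r) (x : R) (D : nat) i j :
  A \in unitmx -> 1 <= x -> (0 < D)%N -> (forall i j, `|A i j| <= x) ->
  (forall i j, A i j * D%:R \is a Num.int) ->
  `|invmx A i j| <= r`!%:R * (x * D%:R) ^+ r.
Proof.
move=> uA x1 D0 Ax AD.
have dA : \det A != 0 by rewrite -unitfE -unitmxE.
have d1 := norm_det_ge1 dA D0 AD.
have x0 : 0 <= x by apply: le_trans x1.
rewrite /invmx uA mxE normrM normfV mulrC ler_pdivrMr ?normr_gt0 //.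
apply: le_trans (_ : r`!%:R * x ^+ r <= _); last first.
  rewrite exprMn -!mulrA ler_wpM2l // ler_peMr ?exprn_ge0 // mulrC //.
rewrite mxE /cofactor normrM normrX normrN1 expr1n mul1r.
apply: le_trans (norm_det_le (x := x) _) _ => [k l|]; first by rewrite !mxE.
apply: ler_pM; rewrite ?exprn_ge0 // ?ler_nat ?leq_fact ?leq_pred //.
by rewrite ler_weXn2l ?leq_pred.
Qed.

End Determinants.

(** * Interpolation on a finite set of points with bounded coefficients *)

Section Interpolation.
Variables (R : realType) (n : nat).

(* [T] indexes an invertible maximal minor of the matrix of the values of all
   monomials of degree at most [d] at the points of [W]. *)
Lemma bounded_interpolation (W : finType) (pt : W -> 'I_n -> R) (a : R) (D d : nat) :
  1 <= a -> (0 < D)%N -> (forall w i, `|pt w i| <= a) ->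
  (forall w i, pt w i * D%:R \is a Num.int) ->
  let N := #|{: 'X_{1..n < d.+1}}| in
  exists2 T : seq W, (size T <= N)%N & forall f : {mpoly R[n]}, deg_le f d ->
    exists g, [/\ deg_le g d, forall w, g.@[pt w] = f.@[pt w]
      & norm1 g <= N%:R * (N`!%:R * (a ^+ d * D%:R ^+ d) ^+ N)
                    * \sum_(w <- T) `|f.@[pt w]|].
Proof.
move=> a1 D0 pta ptD N.
have a0 : 0 <= a by apply: le_trans a1.
pose mon (i : 'I_N) : {mpoly R[n]} := 'X_[(enum_val i : 'X_{1..n < d.+1})].
have mond i : (mdeg (enum_val i : 'X_{1..n < d.+1}) <= d)%N by rewrite -ltnS bmdeg.
pose A : 'M[R]_(N, #|W|) := \matrix_(i, j) (mon i).@[pt (enum_val j)].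
pose r := \rank A.
pose f0 := maxrankfun A; pose A1 : 'M[R]_(r, #|W|) := rowsub f0 A.
have A1full : row_full A1^T by rewrite /row_full mxrank_tr; exact: maxrowsub_free.
(* Rows (monomials) are selected first; [fullrankfun] also selects rows, so the points are chosen on
   the transpose. *)
pose g0 := fullrankfun A1full.
pose C : 'M[R]_r := (rowsub g0 A1^T)^T.
have uC : C \in unitmx by rewrite unitmx_tr fullrowsub_unit.
have CE i j : C i j = (mon (f0 i)).@[pt (enum_val (g0 j))] by rewrite !mxE.
have rN : (r <= N)%N by rewrite rank_leq_row.
have Ca i j : `|C i j| <= a ^+ d.
  rewrite CE -[leRHS]mul1r -(norm1X R (enum_val (f0 i) : 'X_{1..n < d.+1})).
  by apply: ler_meval_norm1; rewrite ?deg_leX.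
have CD i j : C i j * (D ^ d)%:R \is a Num.int.
  rewrite CE mevalX; set m : 'X_{1..n} := bmnm _.
  (* A monomial of degree below [d] needs fewer factors [D]; the surplus ones are integers. *)
  have -> : (D ^ d)%:R = D%:R ^+ (d - mdeg m) * \prod_(k < n) D%:R ^+ (m k) :> R.
    by rewrite prodrXr -mdegE -exprD subnK ?mond // natrX.
  rewrite mulrCA rpredM ?rpredX ?natr_int // -big_split /=.
  by rewrite rpred_prod // => k _; rewrite -exprMn rpredX.
set K := _ * (_ ^+ N).
have invK i j : `|invmx C i j| <= K.
  apply: le_trans (norm_invmx_le i j uC _ _ Ca CD) _.
  - by rewrite exprn_ege1.
  - by rewrite expn_gt0 D0.
  have aD1 : 1 <= a ^+ d * D%:R ^+ d.
    by rewrite -exprMn exprn_ege1 // mulr_ege1 // ler1n.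
  have aD0 : 0 <= a ^+ d * D%:R ^+ d := le_trans ler01 aD1.
  rewrite natrX /K; apply: ler_pM => //; first exact: exprn_ge0.
    by rewrite ler_nat leq_fact.
  exact: ler_weXn2l.
have K0 : 0 <= K.
  by rewrite mulr_ge0 ?exprn_ge0 // mulr_ge0 ?exprn_ge0.
exists [seq enum_val (g0 j) | j <- enum 'I_r].
  by rewrite size_map size_enum_ord.
move=> f fd.
pose ev : 'rV[R]_#|W| := \row_j f.@[pt (enum_val j)].
(* The selected rows span all of the row space, so the chosen monomials reproduce [f] at every point
   of [W], not only at those of [T]. *)
have /submxP[u uE] : (ev <= A1)%MS.
  rewrite eq_maxrowsub; apply/submxP.
  exists (\row_i f@_(enum_val i : 'X_{1..n < d.+1})).
  apply/rowP => j; rewrite !mxE [f in LHS](mpolywE fd) raddf_sum /=.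
  rewrite (big_enum_val (fun m : 'X_{1..n < d.+1} => (f@_m *: 'X_[m]).@[pt (enum_val j)])) /=.
  by apply: eq_bigr => i _; rewrite mevalZ !mxE.
pose evT : 'rV[R]_r := \row_j f.@[pt (enum_val (g0 j))].
(* Restricted to the chosen points the system is square, so the coefficients depend only on the
   values of [f] on [T]. *)
have uT : u = evT *m invmx C.
  apply: (canRL (mulmxK uC)); apply/rowP => j.
  have := congr1 (fun v : 'rV_ _ => v ord0 (g0 j)) uE; rewrite !mxE => ->.
  by apply: eq_bigr => i _; rewrite !mxE.
exists (\sum_(i < r) u ord0 i *: mon (f0 i)); split.
- by apply: deg_le_sum => i _; rewrite deg_leZ // deg_leX.
- move=> w; have := congr1 (fun v : 'rV_ _ => v ord0 (enum_rank w)) uE.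
  rewrite !mxE enum_rankK => ->; rewrite raddf_sum /=.
  by apply: eq_bigr => i _; rewrite mevalZ !mxE enum_rankK.
apply: le_trans (norm1_sum _ _ _) _.
rewrite big_map big_enum /=; set S := \sum_(j in _) `|_|.
have S0 : 0 <= S by apply: sumr_ge0.
apply: le_trans (_ : \sum_(i < r) K * S <= _).
  apply: ler_sum => i _; rewrite norm1Z norm1X mulr1 uT mxE.
  apply: le_trans (ler_norm_sum _ _ _) _; rewrite mulr_sumr; apply: ler_sum => j _.
  by rewrite normrM mulrC !mxE ler_wpM2r.
rewrite sumr_const card_ord -[leLHS]mulr_natl -[leRHS]mulrA.
by rewrite (ler_wpM2r (mulr_ge0 K0 S0)) // ler_nat.
Qed.

End Interpolation.

(** * Multivariate division with bounded quotients *)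

Section Division.
Variables (R : realType) (n : nat).
Implicit Types (f g p r : {mpoly R[n]}) (G : seq {mpoly R[n]}).

Definition lead_multiplier f g : {mpoly R[n]} :=
  (mleadc f / mleadc g) *: 'X_[(mlead f - mlead g)%MM].

Section LeadReduction.
Variables f g : {mpoly R[n]}.
Hypotheses (f0 : f != 0) (g0 : g != 0) (gf : (mlead g <= mlead f)%MM).

Lemma mleadc_div_neq0 : mleadc f / mleadc g != 0.
Proof. by rewrite mulf_neq0 ?invr_neq0 ?mleadc_eq0. Qed.

Lemma mlead_lead_multiplier : mlead (lead_multiplier f g * g) = mlead f.
Proof.
rewrite /lead_multiplier -scalerAl mleadZ ?mleadc_div_neq0 //.
by rewrite mleadM ?mleadXm ?submK // -msize_poly_eq0 msizeX.
Qed.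

Lemma mleadc_lead_multiplier : (lead_multiplier f g * g)@_(mlead f) = mleadc f.
Proof.
have := mcoeffMX g (mlead f - mlead g)%MM (mlead g); rewrite submK // => cE.
by rewrite /lead_multiplier -scalerAl mcoeffZ [_ * g]mulrC cE divfK ?mleadc_eq0.
Qed.

Lemma mlead_lead_reduction :
  f - lead_multiplier f g * g != 0 ->
  (mlead (f - lead_multiplier f g * g) < mlead f)%O.
Proof.
move=> f'0; rewrite lt_neqAle; apply/andP; split; last first.
  by apply: le_trans (mleadB_le _ _) _; rewrite mlead_lead_multiplier leUx lexx.
apply: contraNneq f'0 => eq_lead; rewrite -mleadc_eq0 eq_lead mcoeffB.
by rewrite mleadc_lead_multiplier subrr.
Qed.

(** The order being graded, the leading monomial carries the total degree. The product has the same
    leading monomial as [f], hence the same degree, and the degrees of its factors add up to it. *)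
Lemma deg_le_lead_reduction D : deg_le f D ->
  [/\ deg_le g D, deg_le (lead_multiplier f g) D
    & deg_le (lead_multiplier f g * g) D].
Proof.
have t0 : lead_multiplier f g != 0.
  by rewrite scaler_eq0 negb_or mleadc_div_neq0 -msize_poly_eq0 msizeX.
move=> fD; have tgD : deg_le (lead_multiplier f g * g) D.
  by move: fD; rewrite /deg_le -!mlead_deg ?mulf_neq0 // mlead_lead_multiplier.
split=> //; last exact: deg_leMI tgD.
by apply: deg_leMI t0 _; rewrite mulrC.
Qed.

End LeadReduction.

Lemma mdiv_rem_mlead G p r m : mdiv_rem G p r -> m \in msupp r -> (m <= mlead p)%O.
Proof.
move=> dr; elim: dr m => {p r} [m|p g gs r p0 gE _ IH m mr|p r p0 pE _ IH m].
- by rewrite msupp0.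
- have : g \in lead_divisors G p by rewrite gE mem_head.
  rewrite mem_filter => /andP[/andP[g0 gp] _].
  apply: le_trans (IH m mr) _.
  have [->|f'0] := eqVneq (p - lead_multiplier p g * g) 0; first by rewrite mlead0 le0m.
  exact/ltW/mlead_lead_reduction.
- move=> /msuppD_le; rewrite mem_cat => /orP[mr|/msuppZ_le]; last first.
    by rewrite msuppX mem_seq1 => /eqP->.
  apply: le_trans (IH m mr) _.
  have [->|f'0] := eqVneq (p - mleadc p *: 'X_[mlead p]) 0; first by rewrite mlead0 le0m.
  exact/ltW/ltm_mleadD.
Qed.

(** If no leading monomial divided that of [f], the leading term of [f] would enter the remainder,
    where nothing cancels it: what is added later has smaller monomials. *)
Lemma mdiv_rem0_lead_divisor G f : mdiv_rem G f 0 -> f != 0 ->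
  exists2 g, g \in G & (g != 0) && (mlead g <= mlead f)%MM.
Proof.
have zero z r : mdiv_rem G z r -> z = 0 -> r = 0.
  by case=> // [p ? ? ? p0 _ _|p ? p0 _ _] pz; rewrite pz eqxx in p0.
suff lead_div z : mdiv_rem G f z -> z = 0 -> f != 0 ->
    exists2 g, g \in G & (g != 0) && (mlead g <= mlead f)%MM.
  by move=> /lead_div; apply.
case=> [|p g gs r p0 gE _ _ _|p r p0 _ dr rE _].
- by move=> _; rewrite eqxx.
- have : g \in lead_divisors G p by rewrite gE mem_head.
  by rewrite mem_filter => /andP[gp gG]; exists g.
have r0 : r@_(mlead p) = 0.
  (* A zero dividend is treated apart: [mlead 0] is the unit monomial and need not be smaller than
     [mlead p]. *)
  have [q0|q0] := eqVneq (p - mleadc p *: 'X_[mlead p]) 0.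
    by rewrite (zero _ _ dr q0) mcoeff0.
  apply: memN_msupp_eq0; apply/negP => /(mdiv_rem_mlead dr).
  by apply/negP; rewrite -ltNge ltm_mleadD.
move: rE => /(congr1 (mcoeff (mlead p))).
rewrite mcoeff0 mcoeffD r0 add0r mcoeffZ mcoeffX eqxx mulr1 => /eqP.
by rewrite mleadc_eq0 (negPf p0).
Qed.

(** Within [I] a reduction is always available, so each step cancels a leading term and [N] steps
    suffice. A quotient term costs a factor [2 ^+ X] through the leading coefficient and its product
    with [g] another, so the dividend grows by at most [2 ^+ (2 * X + 1)] per step. *)
Lemma bounded_division G (I : {mpoly R[n]} -> Prop) (D X : nat) :
  (forall f g u, I f -> g \in G -> I (f - u * g)) ->
  (forall f, I f -> f != 0 ->
     exists2 g, g \in G & (g != 0) && (mlead g <= mlead f)%MM) ->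
  (forall g, g \in G -> deg_le g D -> g != 0 ->
     norm1 g <= 2 ^+ X /\ 1 <= `|mleadc g| * 2 ^+ X) ->
  let N := #|{: 'X_{1..n < D.+1}}| in
  forall f, I f -> deg_le f D -> exists s : seq ({mpoly R[n]} * {mpoly R[n]}),
    [/\ f = \sum_(u <- s) u.1 * u.2, (size s <= N)%N
      & forall u, u \in s -> [/\ u.2 \in mtruncate D G, deg_le u.1 D,
           deg_le (u.1 * u.2) D
         & norm1 u.1 <= norm1 f * (2 ^+ (2 * X + 1)) ^+ N]].
Proof.
move=> Isub Ired GX N f If fD.
pose below (m : 'X_{1..n}) := [pred m' : 'X_{1..n < D.+1} | (bmnm m' <= m)%O].
(* The induction is on the number of monomials not above the leading one. The guard covers the end
   of the division: [mlead 0] would still count one monomial. *)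
have : f != 0 -> (#|below (mlead f)| <= N)%N by move=> _; apply: max_card.
set M := 2 ^+ (2 * X + 1).
have M1 : 1 <= M by rewrite exprn_ege1 ?ler1n.
have M0 : 0 <= M := le_trans ler01 M1.
elim: N f If fD => [|N IHN] f If fD cf; have [f0|f0] := eqVneq f 0;
  try by exists [::]; rewrite big_nil f0.
- have bf : (mdeg (mlead f) < D.+1)%N by rewrite mlead_deg.
  have := cf f0; rewrite leqn0 => /eqP/card0_eq/(_ (BMultinom bf)).
  by rewrite !inE lexx.
have [g gG /andP[g0 gf]] := Ired f If f0.
have [gD tD tgD] := deg_le_lead_reduction f0 g0 gf fD.
have [gX lgX] := GX g gG gD g0.
set t := lead_multiplier f g in tD tgD.
have tX : norm1 t <= norm1 f * 2 ^+ X.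
  rewrite norm1Z norm1X mulr1 normrM normfV ler_pdivrMr ?normr_gt0 ?mleadc_eq0 //.
  rewrite -mulrA [_ ^+ X * _]mulrC; apply: le_trans (ler_mcoeff_norm1 _ _) _.
  by rewrite ler_peMr // norm1_ge0.
have X1 : (1 : R) <= 2 ^+ X by rewrite exprn_ege1 ?ler1n.
have ME : M = 2 * (2 ^+ X * 2 ^+ X) by rewrite /M addn1 exprS mul2n -addnn exprD.
have f'M : norm1 (f - t * g) <= norm1 f * M.
  apply: le_trans (norm1B _ _) _.
  apply: le_trans (lerD (lexx _) (norm1M _ _)) _.
  apply: le_trans (_ : norm1 f + norm1 f * 2 ^+ X * 2 ^+ X <= _).
    by rewrite lerD2l ler_pM ?norm1_ge0.
  by have := ler_peMr (norm1_ge0 f) (mulr_ege1 X1 X1); rewrite ME; lra.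
have [||f'0|s [sE sN sP]] := IHN (f - t * g).
- exact: Isub.
- exact: deg_leB.
- have lt_lead := mlead_lead_reduction f0 g0 gf f'0.
  have bf : (mdeg (mlead f) < D.+1)%N by rewrite mlead_deg.
  rewrite -ltnS; apply: leq_trans (cf f0); apply: proper_card.
  apply/properP; split.
    by apply/fintype.subsetP => m; rewrite !inE => /le_trans; apply; exact: ltW.
  by exists (BMultinom bf); rewrite !inE ?lexx // -ltNge.
exists ((t, g) :: s); split; [by rewrite big_cons -sE addrC subrK | by [] |].
move=> u; rewrite inE => /predU1P[->|/sP[uG uD uuD uM]]; split=> //=.
- by rewrite mem_filter gD.
- apply: le_trans tX _; rewrite ler_wpM2l ?norm1_ge0 //.
  apply: le_trans (_ : M <= _); last by rewrite [leRHS]exprS ler_peMr // exprn_ege1.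
  by rewrite ME; nra.
- apply: le_trans uM _; by rewrite [M ^+ N.+1]exprS mulrA ler_wpM2r // exprn_ge0.
Qed.

End Division.

(** * Elementary inequalities *)

Section RealAux.
Variable R : realType.

Lemma sqr_sum_le I (s : seq I) (a : I -> R) :
  (\sum_(x <- s) a x) ^+ 2 <= (size s)%:R * \sum_(x <- s) a x ^+ 2.
Proof.
have amgm y t : 2 * y * \sum_(x <- t) a x <=
    (size t)%:R * y ^+ 2 + \sum_(x <- t) a x ^+ 2.
  elim: t => [|x t IHt]; first by rewrite !big_nil mulr0 mul0r addr0.
  by rewrite !big_cons /= -natr1; have := sqr_ge0 (y - a x); move: IHt; lra.
elim: s => [|x s IHs]; first by rewrite !big_nil expr0n mul0r.
by rewrite !big_cons /= -natr1; have := amgm (a x) s; move: IHs; lra.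
Qed.

Lemma ler_nat_exp2 k : (k%:R : R) <= 2 ^+ k.
Proof. by rewrite -natrX ler_nat ltnW // ltn_expl. Qed.

Lemma exp2D_le (i j k : nat) : (i < k)%N -> (j < k)%N ->
  2 ^+ i + 2 ^+ j <= 2 ^+ k :> R.
Proof.
case: k => // k; rewrite !ltnS => ik jk.
have -> : 2 ^+ k.+1 = 2 ^+ k + 2 ^+ k :> R by rewrite exprS; ring.
by rewrite lerD // ler_eXn2l ?ltr1n.
Qed.

Lemma fact_le_expn k : (k`! <= k ^ k)%N.
Proof.
elim: k => // k IHk; rewrite factS expnS leq_mul2l (leq_trans IHk) //.
by case: (posnP k) => [->|k0] //; rewrite leq_exp2r.
Qed.

Lemma leq_fact_exp2 k : (k`! <= 2 ^ (k * k))%N.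
Proof.
rewrite (leq_trans (fact_le_expn k)) // expnM.
by case: k => // k; rewrite leq_exp2r // ltnW // ltn_expl.
Qed.

End RealAux.

(** * Completing the square *)

Section AddConstant.
Variables (R : realType) (n : nat) (P : seq {mpoly R[n]}).

(* [f + eta = (alpha f + beta)^2 - alpha^2 f^2] with [2 alpha beta = 1] and
   [beta^2 = eta]. *)
Lemma certificate_add_const D D' (f : {mpoly R[n]}) (A K eta : R) :
  0 < eta -> deg_le f D' -> (2 * D' <= D)%N -> norm1 f <= A ->
  certificate P D K (- f ^+ 2) ->
  certificate P D ((A ^+ 2 + K) / eta + 2 * eta) (f + eta%:MP).
Proof.
move=> eta0 fD DD fA cf.
have K0 : 0 <= K by case: cf.
pose beta := Num.sqrt eta; pose alpha := (2 * beta)^-1.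
have beta0 : 0 < beta by rewrite sqrtr_gt0.
have alpha0 : 0 < alpha by rewrite invr_gt0 mulr_gt0.
have beta2 : beta ^+ 2 = eta by rewrite sqr_sqrtr // ltW.
have alpha2 : alpha ^+ 2 = (4 * eta)^-1.
  by rewrite exprVn exprMn beta2; congr (_ * _)^-1; rewrite expr2; ring.
have ab : 2 * alpha * beta = 1 by rewrite /alpha; field; rewrite gt_eqF.
have -> : f + eta%:MP = (alpha *: f + beta%:MP) ^+ 2 + alpha ^+ 2 *: (- f ^+ 2).
  rewrite -!mul_mpolyC -beta2 !expr2 !mpolyCM.
  have abM : 2 * alpha%:MP * beta%:MP = 1 :> {mpoly R[n]}.
    have -> : 2 = 2%:MP :> {mpoly R[n]} by rewrite rmorph_nat.
    by rewrite -!mpolyCM ab.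
  transitivity (2 * alpha%:MP * beta%:MP * f + beta%:MP * beta%:MP); last by ring.
  by rewrite abM mul1r.
have dl : deg_le (alpha *: f + beta%:MP) D' by rewrite deg_leD ?deg_leZ ?deg_leC.
have h1 := certificateW DD (lexx _) (certificate_sqr P dl).
apply: certificateW (certificateD h1 (certificateZ (sqr_ge0 alpha) cf)) => //.
have fA2 : norm1 f ^+ 2 <= A ^+ 2.
  by rewrite lerXn2r // nnegrE ?norm1_ge0 // (le_trans (norm1_ge0 f)).
have l1 : norm1 (alpha *: f + beta%:MP) ^+ 2 <= 2 * (alpha ^+ 2 * A ^+ 2) + 2 * eta.
  apply: le_trans (_ : (alpha * norm1 f + beta) ^+ 2 <= _).
    rewrite lerXn2r ?nnegrE ?norm1_ge0 //.
      by rewrite addr_ge0 ?mulr_ge0 ?norm1_ge0 // ltW.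
    by rewrite (le_trans (norm1D _ _)) // norm1Z norm1C !gtr0_norm.
  have := sqr_ge0 (alpha * norm1 f - beta).
  have : alpha ^+ 2 * norm1 f ^+ 2 <= alpha ^+ 2 * A ^+ 2 by rewrite ler_wpM2l ?sqr_ge0.
  by rewrite -beta2; nra.
apply: le_trans (lerD l1 (lexx _)) _.
have -> : alpha ^+ 2 = eta^-1 / 4 by rewrite alpha2 invfM mulrC.
have A0 : 0 <= A ^+ 2 * eta^-1 by rewrite mulr_ge0 ?sqr_ge0 // invr_ge0 ltW.
have K1 : 0 <= K * eta^-1 by rewrite mulr_ge0 // invr_ge0 ltW.
by lra.
Qed.

End AddConstant.

(** * New squares and new multipliers over a finite domain *)

Section FiniteDomain.
Variables (R : realType) (n q : nat) (rho : 'I_q -> rat).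
Implicit Types (P G L : seq {mpoly R[n]}).

Definition domain_bounded_by (kappa : nat) : Prop :=
  [/\ sqr_bounded_by R rho kappa, forall i, `|ratr (rho i) : R| <= 2 ^+ kappa
    & exists2 D : nat, (0 < D <= 2 ^ kappa)%N &
        forall i, (ratr (rho i) : R) * D%:R \is a Num.int].

Definition domain_point (w : {ffun 'I_n -> 'I_q}) : 'I_n -> R :=
  fun j => ratr (rho (w j)).

Lemma variety_domain_point P v : over_domain rho P -> variety P v ->
  exists w, v =1 domain_point w.
Proof.
move=> dP Pv.
have /choice[w wE] j : exists i, v j = ratr (rho i).
  have : (domain_poly R rho j).@[v] = 0 by apply: Pv; apply: dP; exact: codom_f.
  rewrite /domain_poly rmorph_prod /= => /eqP/prodf_eq0[i _].
  by rewrite mevalB mevalXU mevalC subr_eq0 => /eqP; exists i.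
by exists (finfun w) => j; rewrite /domain_point ffunE.
Qed.

Lemma lincomb_variety P h v : variety P v -> (@lincomb R n P h).@[v] = 0.
Proof.
move=> Pv; rewrite /lincomb raddf_sum big1 // => i _.
have Pi0 : (P`_i).@[v] = 0 by apply: Pv; exact: mem_nth.
by rewrite /= mevalM Pi0 mulr0.
Qed.

Lemma sos_proof_deg_le P r D s h : @sos_proof R n P r D s h -> deg_le r D.
Proof.
move=> [-> ds dh]; apply: deg_leD; last exact: deg_le_sum.
by rewrite big_seq; apply: deg_le_sum.
Qed.

(** Exponents of the factors in [bounded_interpolation]: [N], then [N!], at most [2 ^ (N * N)], then
    the [N]-th power of [a ^ d * D ^ d] with [a] and [D] at most [2 ^ kappa]. *)
Definition interpolation_exponent (kappa d N : nat) : nat :=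
  (N + N * N + 2 * kappa * d * N)%N.

(** The interpolation bound is squared, one [N] comes from Cauchy-Schwarz and one from the number of
    points; [X + 2 * d * kappa] bounds [r] at a point. *)
Definition squares_exponent (kappa d N X : nat) : nat :=
  (2 * interpolation_exponent kappa d N + 2 * N + X + 2 * d * kappa)%N.

Lemma bounded_sum_of_squares P r kappa d N X s h :
  domain_bounded_by kappa -> over_domain rho P -> norm1 r <= 2 ^+ X ->
  (#|{: 'X_{1..n < d.+1}}| <= N)%N -> @sos_proof R n P r (2 * d) s h ->
  exists g, [/\ certificate P (2 * d) (2 ^+ squares_exponent kappa d N X) g,
    norm1 g <= 2 ^+ squares_exponent kappa d N X, deg_le g (2 * d)
    & vanishing_ideal (variety P) (r - g)].
Proof.
move=> [_ rhoK [D /andP[D0 DK] rhoD]] dP rX cardN sos.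
have dr := sos_proof_deg_le sos; case: sos => rE ds _.
pose inV (w : {ffun 'I_n -> 'I_q}) := all (fun p => p.@[domain_point w] == 0) P.
pose W := {w | inV w}; pose pt (w : W) := domain_point (val w).
have ptV w : variety P (pt w).
  by move=> p pP; apply/eqP; have /allP := valP w; apply.
have a1 : (1 : R) <= 2 ^+ kappa by rewrite exprn_ege1 ?ler1n.
have rpt w : r.@[pt w] = \sum_(f <- s) f.@[pt w] ^+ 2.
  rewrite rE mevalD lincomb_variety // addr0 raddf_sum /=.
  by apply: eq_bigr => f _; rewrite rmorphXn.
have [T TN Tint] := @bounded_interpolation R n W pt (2 ^+ kappa) D d
  a1 D0 (fun w i => rhoK _) (fun w i => rhoD _).
(* The degree condition moves under the existential so that [choice] gives a total function
   [tau]. *)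
have {}Tint f : exists g, deg_le f d -> [/\ deg_le g d,
    forall w, g.@[pt w] = f.@[pt w]
    & norm1 g <= 2 ^+ interpolation_exponent kappa d N * \sum_(w <- T) `|f.@[pt w]|].
  have [/Tint[g [gd gE gN]]|] := boolP (deg_le f d); last by exists 0.
  exists g => _; split=> //; apply: le_trans gN _.
  rewrite ler_wpM2r ?sumr_ge0 // /interpolation_exponent !exprD -mulrA.
  move: cardN; set M := #|_| => MN.
  have exp_le i j : (i <= j)%N -> (2 : R) ^+ i <= 2 ^+ j.
    by move=> ij; rewrite ler_eXn2l ?ltr1n.
  apply: ler_pM => //; first by rewrite mulr_ge0 ?exprn_ge0 ?mulr_ge0 ?exprn_ge0.
    by apply: le_trans (ler_nat_exp2 R M) _; exact: exp_le.
  apply: ler_pM => //; first by rewrite exprn_ge0 ?mulr_ge0 ?exprn_ge0.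
    apply: le_trans (_ : 2 ^+ (M * M) <= _); last by rewrite exp_le ?leq_mul.
    by rewrite -natrX ler_nat leq_fact_exp2.
  apply: le_trans (_ : (2 ^+ (2 * kappa * d)) ^+ M <= _); last first.
    by rewrite -exprM exp_le // leq_mul2l MN orbT.
  rewrite lerXn2r ?nnegrE ?mulr_ge0 ?exprn_ge0 //.
  have -> : (2 * kappa * d = kappa * d + kappa * d)%N by rewrite -mulnA mul2n addnn.
  rewrite exprD -!exprM ler_wpM2l ?exprn_ge0 // exprM lerXn2r ?nnegrE ?exprn_ge0 //.
  by rewrite -natrX ler_nat.
have /choice[tau tauP] := Tint.
have sd f : f \in s -> deg_le f d by move=> /ds; rewrite deg_le_sqr.
pose g := \sum_(f <- s) tau f ^+ 2.
have g_le : \sum_(f <- s) norm1 (tau f) ^+ 2 <= 2 ^+ squares_exponent kappa d N X.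
  set E := interpolation_exponent kappa d N in tauP *.
  apply: le_trans (_ : \sum_(f <- s)
      2 ^+ (2 * E) * (N%:R * \sum_(w <- T) f.@[pt w] ^+ 2) <= _).
    rewrite big_seq [leRHS]big_seq; apply: ler_sum => f fs.
    have [_ _ tN] := tauP f (sd f fs).
    apply: le_trans (_ : (2 ^+ E * \sum_(w <- T) `|f.@[pt w]|) ^+ 2 <= _).
      by rewrite lerXn2r // nnegrE ?norm1_ge0 // mulr_ge0 ?exprn_ge0 ?sumr_ge0.
    rewrite exprMn -exprM [(E * 2)%N]mulnC ler_wpM2l ?exprn_ge0 //.
    apply: le_trans (sqr_sum_le _ _) _.
    rewrite (eq_bigr (fun w => f.@[pt w] ^+ 2)) => [|w _]; last by rewrite real_normK ?num_real.
    by rewrite ler_wpM2r ?ler_nat ?(leq_trans TN) // sumr_ge0 // => w _; exact: sqr_ge0.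
  (* Summing over the squares first turns the inner sum into [r] at a point: neither their number
     nor their individual size matters. *)
  rewrite -!mulr_sumr exchange_big /=.
  have rw w : \sum_(f <- s) f.@[pt w] ^+ 2 <= 2 ^+ (X + 2 * d * kappa).
    rewrite -rpt (le_trans (ler_norm _)) // exprD [(2 * d * kappa)%N]mulnC exprM.
    apply: le_trans (ler_meval_norm1 a1 (fun i => rhoK _) dr) _.
    by rewrite ler_wpM2r ?exprn_ge0 // exprn_ge0.
  apply: le_trans (_ : 2 ^+ (2 * E) * (2 ^+ N * (2 ^+ N * 2 ^+ (X + 2 * d * kappa))) <= _).
    rewrite ler_wpM2l ?exprn_ge0 //.
    apply: ler_pM => //.
    - by apply: sumr_ge0 => w _; apply: sumr_ge0 => f _; exact: sqr_ge0.
    - exact: ler_nat_exp2.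
    apply: le_trans (ler_sum _ (fun w _ => rw w)) _.
    rewrite big_const_seq count_predT iter_addr_0 -[leLHS]mulr_natl ler_wpM2r ?exprn_ge0 //.
    by apply: le_trans (ler_nat_exp2 R N); rewrite ler_nat (leq_trans TN).
  by rewrite -!exprD ler_eXn2l ?ltr1n // /squares_exponent -/E; clear; lia.
exists g; split.
- apply: certificateW (leqnn _) g_le _; rewrite /g big_seq [X in certificate _ _ _ X]big_seq.
  by apply: certificate_sum => f fs; apply: certificate_sqr; case: (tauP f (sd f fs)).
- apply: le_trans (norm1_sum _ _ _) (le_trans _ g_le); apply: ler_sum => f _.
  by rewrite expr2 norm1M.
- rewrite /g big_seq; apply: deg_le_sum => f fs.
  by rewrite deg_le_sqr; case: (tauP f (sd f fs)).
move=> v Pv; have [w vw] := variety_domain_point dP Pv.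
have wV : inV w.
  by apply/allP => p pP; rewrite -(meval_eq _ vw) (Pv p pP).
rewrite (meval_eq _ vw) -[w](SubK W wV) -/(pt _) mevalB rpt.
suff -> : g.@[pt (Sub w wV)] = \sum_(f <- s) f.@[pt (Sub w wV)] ^+ 2 by rewrite subrr.
rewrite /g raddf_sum /= big_seq [RHS]big_seq; apply: eq_bigr => f fs.
by rewrite rmorphXn /=; have [_ -> _] := tauP f (sd f fs).
Qed.

(** [F + (2 * X + 1) * N] bounds the quotients and [(14 * X + kappa + 5) * X] the certificates of
    [- g ^+ 2]. One [N], with [Y], comes from [1/eta], the other from the number of products. *)
Definition ideal_exponent (kappa N X Y F : nat) : nat :=
  (2 * (F + (2 * X + 1) * N) + 2 * X + (14 * X + kappa + 5) * X + 2 * N + Y + 3)%N.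

(** Division respects the degree, so only elements of the truncated basis, which have derivations,
    occur. Each product receives a share [eps / N] of the constant. *)
Lemma certificate_ideal P G kappa d D N X Y F (f : {mpoly R[n]}) (eps : R) :
  sqr_bounded_by R rho kappa -> over_domain rho P ->
  grobner_basis (vanishing_ideal (variety P)) G ->
  (forall g, g \in mtruncate (2 * d) G -> exists L,
     [/\ pc_derivation rho P L g, bitsize_le L X & forall f, f \in L -> deg_le f D]) ->
  (#|{: 'X_{1..n < (2 * d).+1}}| <= N)%N -> (0 < N)%N ->
  vanishing_ideal (variety P) f -> deg_le f (2 * d) -> norm1 f <= 2 ^+ F ->
  0 < eps -> eps <= 2 ^+ Y -> eps^-1 <= 2 ^+ Y ->
  certificate P (4 * d + 2 * D + 2 * kappa) (2 ^+ ideal_exponent kappa N X Y F)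
    (f + eps%:MP).
Proof.
move=> sK dP [GI _ Gdiv] GL cardN N0 If fd fF eps0 epsY epsVY.
(* A derivation of [g] ends with [g], so its bit size bounds the coefficients of [g] above and its
   leading coefficient below; it also bounds the number of lines. *)
have GB g : g \in mtruncate (2 * d) G -> [/\ norm1 g <= 2 ^+ X,
    g != 0 -> 1 <= `|mleadc g| * 2 ^+ X
  & certificate P (2 * D + 2 * kappa) (2 ^+ ((14 * X + kappa + 5) * X)) (- g ^+ 2)].
  move=> /GL[L [[steps L0 Lg] LX LD]].
  have gE : g = L`_(size L).-1 by rewrite nth_last Lg.
  have sL : ((size L).-1 < size L)%N by rewrite prednK.
  have gL : g \in L by rewrite gE mem_nth.
  split; first exact: norm1_bitsize_le LX gL.
    by move=> g0; apply: bounded_den_ge (bounded_den_bitsize_le _ LX gL); rewrite mleadc_eq0.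
  have := pc_certificate sK dP LX LD steps sL; rewrite -gE prednK //.
  apply: certificateW => //; rewrite -exprM ler_eXn2l ?ltr1n // leq_mul2l.
  by rewrite (size_bitsize_le LX) orbT.
have eX (i j : nat) : (i <= j)%N -> (2 : R) ^+ i <= 2 ^+ j.
  by move=> ij; rewrite ler_eXn2l ?ltr1n.
have [|||s [fE sN sP]] := @bounded_division R n G
    (vanishing_ideal (variety P)) (2 * d) X _ _ _ f If fd.
- move=> p g u Ip gG v Pv; rewrite mevalB mevalM (Ip v Pv) (GI g gG v Pv).
  by rewrite mulr0 subr0.
- by move=> p /Gdiv dp p0; apply: mdiv_rem0_lead_divisor dp p0.
- move=> g gG gd g0; have [|gX lgX _] := GB g; first by rewrite mem_filter gd.
  by split=> //; apply: lgX.
have {}sN := leq_trans sN cardN.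
set E1 := (F + (2 * X + 1) * N)%N.
have uE1 u : u \in s -> norm1 u.1 <= 2 ^+ E1.
  move=> /sP[_ _ _ /le_trans]; apply; rewrite [leRHS]exprD; apply: ler_pM => //.
  - exact: norm1_ge0.
  - by rewrite exprn_ge0 ?exprn_ge0.
  - by rewrite -exprM eX // leq_mul2l cardN orbT.
set Z := ((14 * X + kappa + 5) * X)%N in GB.
pose eta := eps / N%:R.
have NR : 0 < N%:R :> R by rewrite ltr0n.
have eta0 : 0 < eta by rewrite divr_gt0.
have etaY : eta <= 2 ^+ Y.
  by apply: le_trans epsY; rewrite ler_pdivrMr // ler_peMr ?ler1n // ltW.
have etaVY : eta^-1 <= 2 ^+ (N + Y).
  rewrite invfM invrK mulrC exprD; apply: ler_pM; rewrite ?ler_nat_exp2 //.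
  by rewrite invr_ge0 ltW.
set E2 := (2 * E1 + 2 * X + Z + N + Y + 2)%N.
have cu u : u \in s -> certificate P (4 * d + 2 * D + 2 * kappa) (2 ^+ E2)
    (u.1 * u.2 + eta%:MP).
  move=> us; have [u2G u1d ud _] := sP u us; have [u2X _ cu2] := GB _ u2G.
  have u1E := uE1 u us.
  have cw : certificate P (4 * d + 2 * D + 2 * kappa) (2 ^+ (2 * E1 + Z))
      (- (u.1 * u.2) ^+ 2).
    have -> : - (u.1 * u.2) ^+ 2 = u.1 ^+ 2 * (- u.2 ^+ 2) by ring.
    apply: certificateW (certificateM u1d cu2); first by rewrite mulnA addnA.
    rewrite exprD ler_wpM2r ?exprn_ge0 // [(2 * E1)%N]mulnC exprM.
    by rewrite lerXn2r // nnegrE ?norm1_ge0 // exprn_ge0.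
  have wA : norm1 (u.1 * u.2) <= 2 ^+ (E1 + X).
    by apply: le_trans (norm1M _ _) _; rewrite exprD; apply: ler_pM; rewrite ?norm1_ge0.
  have dd : (2 * (2 * d) <= 4 * d + 2 * D + 2 * kappa)%N.
    by rewrite mulnA -addnA leq_addr.
  apply: certificateW (leqnn _) _ (certificate_add_const eta0 ud dd wA cw).
  have -> : 2 ^+ E2 = 2 ^+ E2.-1 + 2 ^+ E2.-1 :> R.
    by rewrite /E2 addn2 exprS; ring.
  apply: lerD.
    apply: le_trans (_ : 2 ^+ (2 * E1 + 2 * X + Z + 1) * 2 ^+ (N + Y) <= _); last first.
      by rewrite -exprD eX // /E2; clear; lia.
    apply: ler_pM => //; rewrite ?invr_ge0 ?(ltW eta0) //.
      by rewrite addr_ge0 ?exprn_ge0 ?exprn_ge0.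
    by rewrite -exprM exp2D_le //; clear; lia.
  by apply: le_trans (_ : 2 * 2 ^+ Y <= _); rewrite ?ler_wpM2l // -exprS eX // /E2; clear; lia.
(* With fewer than [N] products, the unspent part of [eps] is a nonnegative constant, hence a
   square. *)
have rest0 : 0 <= eps - (size s)%:R * eta.
  rewrite subr_ge0 /eta mulrCA -[leRHS]mulr1 ler_wpM2l ?(ltW eps0) //.
  by rewrite ler_pdivrMr // mul1r ler_nat.
have -> : f + eps%:MP = \sum_(u <- s) (u.1 * u.2 + eta%:MP) +
    (eps - (size s)%:R * eta)%:MP.
  rewrite big_split /= -fE big_const_seq count_predT iter_addr_0 -addrA.
  by congr (_ + _); rewrite -mpolyCMn -mpolyCD addrC mulr_natl subrK.
have cs : certificate P (4 * d + 2 * D + 2 * kappa) (\sum_(u <- s) 2 ^+ E2)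
    (\sum_(u <- s) (u.1 * u.2 + eta%:MP)).
  by rewrite big_seq [X in certificate _ _ _ X]big_seq; apply: certificate_sum.
apply: certificateW (leqnn _) _ (certificateD cs (certificate_const _ _ rest0)).
rewrite big_const_seq count_predT iter_addr_0.
apply: le_trans (_ : 2 ^+ (N + E2) + 2 ^+ Y <= _).
  apply: lerD; last first.
    by apply: le_trans epsY; rewrite gerBl mulr_ge0 // ltW.
  rewrite -[leLHS]mulr_natl exprD ler_wpM2r ?exprn_ge0 //.
  by apply: le_trans (ler_nat_exp2 R N); rewrite ler_nat.
by apply: exp2D_le; rewrite /ideal_exponent /E2 /E1 /Z; clear; lia.
Qed.

End FiniteDomain.

(** * Explicit exponents and the final form of the bound *)

Section Asymptotics.

(** Rewrites the monomial count in terms of [n ^ d], leaving a factor that depends on [d] only. The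
    successor of [n ^ d] covers [n = 0]. *)
Lemma count_exponent_le n d : (n.+1 ^ (2 * d) <= 4 ^ d * (n ^ d).+1 ^ 2)%N.
Proof.
have le1 : (n.+1 ^ d <= 2 ^ d * (n ^ d).+1)%N.
  case: n => [|n]; first by rewrite exp1n muln_gt0 expn_gt0.
  apply: leq_trans (_ : (2 * n.+1) ^ d <= _)%N.
    by case: d => // d; rewrite leq_exp2r //; lia.
  by rewrite expnMn leq_mul2l leqnSn orbT.
have -> : (4 ^ d = (2 ^ d) ^ 2)%N by rewrite -expnM mulnC expnM.
by rewrite -expnMn mulnC expnM leq_exp2r.
Qed.

Lemma leq_expn_self n d : (0 < d)%N -> (n <= n ^ d)%N.
Proof. by case: d => // d _; case: n => // n; rewrite expnS leq_pmulr ?expn_gt0. Qed.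

(** For fixed [kappa] the combined exponent is quadratic in the parameters, all at most [U]. The
    inner successor pays for subtracting [g] from [r], the outer one for adding the certificate of
    [g]. *)
Lemma ideal_exponent_le kappa d N X Y U :
  (d <= U)%N -> (N <= U)%N -> (X <= U)%N -> (Y <= U)%N -> (0 < U)%N ->
  ((ideal_exponent kappa N X Y (squares_exponent kappa d N X).+1).+1
     <= (60 + 20 * kappa) * U ^ 2)%N.
Proof.
move=> dU NU XU YU U0.
rewrite /ideal_exponent /squares_exponent /interpolation_exponent.
have h1 : (N * N <= U * U)%N by rewrite leq_mul.
have h2 : (d * N <= U * U)%N by rewrite leq_mul.
have h3 : (X * N <= U * U)%N by rewrite leq_mul.
have h4 : (X * X <= U * U)%N by rewrite leq_mul.
have h5 : (U <= U * U)%N by rewrite leq_pmulr.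
have k2 : (kappa * (d * N) <= kappa * (U * U))%N by rewrite leq_mul.
have k3 : (kappa * d <= kappa * (U * U))%N by rewrite leq_mul // (leq_trans dU).
have k4 : (kappa * X <= kappa * (U * U))%N by rewrite leq_mul // (leq_trans XU).
by rewrite -mulnn; nia.
Qed.

Variable R : realType.

Lemma exists_exp2_bounds (xs : seq R) :
  exists k : nat, forall x, x \in xs -> x <= 2 ^+ k.
Proof.
elim: xs => [|x xs [k IHk]]; first by exists 0%N.
exists (maxn (Num.truncn `|x|).+1 k) => y; rewrite inE => /predU1P[->|yxs].
  apply: le_trans (_ : 2 ^+ (Num.truncn `|x|).+1 <= _); last first.
    by rewrite ler_eXn2l ?ltr1n // leq_maxl.
  apply: le_trans (ler_nat_exp2 R _); apply: le_trans (ler_norm x) _.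
  by have /andP[_ /ltW] := truncn_itv (normr_ge0 x).
by apply: le_trans (IHk y yxs) _; rewrite ler_eXn2l ?ltr1n // leq_maxr.
Qed.

Lemma exists_domain_bound q (rho : 'I_q -> rat) : injective rho ->
  exists kappa, domain_bounded_by R rho kappa.
Proof.
move=> rho_inj; pose c : R := \sum_(i < q) `|ratr (rho i)|.
have rho_c i : `|ratr (rho i)| <= c by rewrite /c (bigD1 i) //= lerDl sumr_ge0.
have [s [g sgE]] := sqr_bound_certificate rho_inj rho_c.
pose D := (\prod_(i < q) absz (denq (rho i)))%N.
have D0 : (0 < D)%N by rewrite prodn_gt0 // => i; rewrite absz_gt0 denq_neq0.
have DE i : exists D', D = (absz (denq (rho i)) * D')%N.
  by exists (\prod_(j < q | j != i) absz (denq (rho j)))%N; rewrite /D (bigD1 i).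
have [k kP] := exists_exp2_bounds
  [:: c; c ^+ 2; (\sum_(i < size s) `|s`_i|) ^+ 2; \sum_(i < size g) `|g`_i|; D%:R].
pose kappa := (k + size s + size g + size (domain_upoly R rho))%N.
have le_kappa x : x <= 2 ^+ k -> x <= 2 ^+ kappa.
  by move=> /le_trans; apply; rewrite ler_eXn2l ?ltr1n // /kappa -!addnA leq_addr.
exists kappa; split.
- exists c, s, g; split=> //; first by split; apply: le_kappa; apply: kP; rewrite !inE eqxx ?orbT.
    by apply: le_kappa; apply: kP; rewrite !inE eqxx ?orbT.
  by rewrite /kappa; clear; lia.
- by move=> i; apply: le_trans (rho_c i) _; apply: le_kappa; apply: kP; rewrite mem_head.
exists D.
  rewrite D0 -(ler_nat R) natrX; apply: le_kappa; apply: kP.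
  by rewrite !inE eqxx ?orbT.
move=> i; have [D' ->] := DE i; rewrite natrM mulrA rpredM ?natr_int //.
rewrite -[(absz _)%:R]/((absz (denq (rho i)))%:Z%:~R) absz_denq.
by rewrite /ratr divfK ?intr_int // intr_eq0 denq_eq0.
Qed.

Lemma powR2_lg (x : R) : 0 < x -> 2 `^ lg x = x.
Proof.
move=> x0; apply: ln_inj; rewrite ?posrE ?powR_gt0 //.
by rewrite ln_powR /lg divfK // gt_eqF // ln_gt0 // ltr1n.
Qed.

Lemma lgV (x : R) : 0 < x -> lg x^-1 = - lg x.
Proof. by move=> x0; rewrite /lg lnV ?posrE // mulNr. Qed.

(** With the absolute value, one [Y] serves both [eps] and its inverse. *)
Lemma le_exp2_lg (x : R) (Y : nat) : 0 < x -> `|lg x| <= Y%:R -> x <= 2 ^+ Y.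
Proof.
move=> x0 xY; rewrite -{1}(powR2_lg x0) -powR_mulrn //.
by apply: ler_powR; rewrite ?ler1n // (le_trans (ler_norm _)).
Qed.

Lemma expD1_le (x : R) E : 0 <= x -> (x + 1) ^+ E <= 2 ^+ E * (x ^+ E + 1).
Proof.
move=> x0; have [x1|/ltW x1] := leP x 1.
  apply: le_trans (_ : 2 ^+ E <= _); first by rewrite lerXn2r ?nnegrE; lra.
  by rewrite ler_peMr ?exprn_ge0 // lerDr exprn_ge0.
apply: le_trans (_ : (2 * x) ^+ E <= _); first by rewrite lerXn2r ?nnegrE; lra.
by rewrite exprMn ler_wpM2l ?exprn_ge0 // lerDl.
Qed.

(** Both [T.+1] and [Y] are at most [T + l + 1], so the base is at most [A.+1] times its [e]-th
    power; [expD1_le] then splits off the 1. *)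
Lemma exp2_le_powR (M A T Y e : nat) (l : R) : 0 <= l -> Y%:R <= l + 1 -> (0 < e)%N ->
  2 ^+ (M * (A * T.+1 ^ e + Y) ^ 2) <=
  2 `^ ((M * A.+1 ^ 2 * 2 ^ (e * 2))%:R * (T%:R + l) ^+ (e * 2)
        + (M * A.+1 ^ 2 * 2 ^ (e * 2))%:R).
Proof.
move=> l0 Yl e0; rewrite -[leLHS]powR_mulrn //; apply: ler_powR; first by rewrite ler1n.
have x0 : 0 <= T%:R + l by rewrite addr_ge0.
have UE : (A * T.+1 ^ e + Y)%:R <= A.+1%:R * (T%:R + l + 1) ^+ e.
  rewrite natrD natrM natrX -[A.+1%:R]natr1 mulrDl mul1r; apply: lerD.
    rewrite ler_wpM2l // lerXn2r ?nnegrE ?addr_ge0 // -natr1; lra.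
  apply: le_trans (_ : T%:R + l + 1 <= _).
    by apply: le_trans Yl _; rewrite lerD2r lerDr.
  by case: e e0 => // e _; rewrite exprS ler_peMr ?exprn_ege1 ?addr_ge0 // lerDr.
rewrite -[X in _ <= _ + X]mulr1 -mulrDr !natrM !natrX -!mulrA ler_wpM2l //.
apply: le_trans (_ : (A.+1%:R * (T%:R + l + 1) ^+ e) ^+ 2 <= _).
  by rewrite -expr2 lerXn2r // nnegrE ?mulr_ge0 ?exprn_ge0 ?addr_ge0.
rewrite [leRHS]mulrA -expr2 exprMn -exprM ler_wpM2l ?exprn_ge0 //.
exact: expD1_le.
Qed.

End Asymptotics.

(* Asymptotics: every O(d) is [b * d] or [B * d] and every poly(N) is
   [c * N ^ e + c] or [C * N ^ E + C].  The constants of the conclusion depend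
   only on the domain and on the constants of the hypotheses; the factor C may
   also depend on the fixed d, but B and E do not.  A polynomial in lg(1/eps)
   is taken in its absolute value, so that eps > 1 is covered too. *)
Theorem mainTheorem1 (R : realType) (k : nat) (rho : 'I_(2 * k) -> rat)
    (rho_inj : injective rho) (b e : nat) :
  exists B E : nat, forall (d c : nat), (0 < d)%N -> exists C : nat,
  forall (n : nat) (P : seq {mpoly R[n]}) (r : {mpoly R[n]})
         (G : seq {mpoly R[n]}),
    over_domain rho P ->
    bitsize_le P (c * n ^ e + c)%N ->
    bitsize_le [:: r] (c * n ^ e + c)%N ->
    (forall v, variety P v -> 0 <= r.@[v]) ->
    (exists s h, @sos_proof R n P r (2 * d) s h) ->
    grobner_basis (vanishing_ideal (variety P)) G ->
    seq_mnorm (mtruncate (2 * d) G) <= 2 ^+ (c * (n ^ d) ^ e + c)%N ->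
    (forall g, g \in mtruncate (2 * d) G ->
       exists L, [/\ pc_derivation rho P L g,
                     bitsize_le L (c * (n ^ d) ^ e + c)%N
                   & forall f, f \in L -> deg_le f (b * d)]) ->
  forall eps : R, 0 < eps ->
    exists s h, @sos_proof R n P (r + eps%:MP) (B * d) s h /\
      forall q, q \in s ++ codom h ++ P ->
        mnorm q <=
          2 `^ (C%:R * ((n ^ d)%N%:R + `|lg eps^-1|) ^+ E + C%:R).
Proof.
have [kappa hk] := exists_domain_bound R rho_inj.
(* The degree reached is [4 * d + 2 * (b * d) + 2 * kappa], and [d] is positive. In the other
   witness, [e] comes from the bit sizes, the inner 2 from the monomial count and the outer 2 from
   the quadratic exponent. *)
exists (4 + 2 * b + 2 * kappa)%N, ((e + 2) * 2)%N => d c d0.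
pose A := (4 ^ d + 2 * c + d + 1)%N.
pose M := (60 + 20 * kappa)%N.
exists (M * A.+1 ^ 2 * 2 ^ ((e + 2) * 2))%N.
move=> n P r G dP bP br _ [s [h sos]] GB _ GL eps eps0.
pose T := (n ^ d)%N; pose X := (c * T ^ e + c)%N.
pose N := (4 ^ d * T.+1 ^ 2)%N; pose l := `|lg eps^-1|.
pose Y := (Num.truncn l).+1; pose U := (A * T.+1 ^ (e + 2) + Y)%N.
pose Phi := (ideal_exponent kappa N X Y (squares_exponent kappa d N X).+1).+1.
have l0 : 0 <= l := normr_ge0 _.
have /andP[trl lY] := truncn_itv l0.
have Te1 : (T.+1 ^ e <= T.+1 ^ (e + 2))%N by rewrite leq_pexp2l ?leq_addr.
have T1 : (1 <= T.+1 ^ (e + 2))%N by rewrite expn_gt0.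
have NU : (N <= U)%N.
  rewrite /N /U /A; have : (T.+1 ^ 2 <= T.+1 ^ (e + 2))%N by rewrite leq_pexp2l ?leq_addl.
  by move: (T.+1 ^ 2)%N (T.+1 ^ (e + 2))%N (4 ^ d)%N; clear; nia.
have XU : (X <= U)%N.
  rewrite /X /U /A; have : (T ^ e <= T.+1 ^ e)%N by case: (e) => // e'; rewrite leq_exp2r.
  move: Te1 T1; move: (T ^ e)%N (T.+1 ^ e)%N (T.+1 ^ (e + 2))%N (4 ^ d)%N; clear; nia.
have dU : (d <= U)%N.
  by rewrite /U /A; move: T1; move: (T.+1 ^ (e + 2))%N (4 ^ d)%N; clear; nia.
have YU : (Y <= U)%N by rewrite leq_addl.
have U0 : (0 < U)%N by rewrite /U /Y addnS.
have PhiU : (Phi <= M * U ^ 2)%N by apply: ideal_exponent_le.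
have XPhi : (X <= Phi)%N.
  by rewrite /Phi /ideal_exponent; move: (squares_exponent _ _ _ _); clear; nia.
have cX : (c * n ^ e + c <= X)%N.
  rewrite /X leq_add2r leq_mul2l; case: (e) => [|e']; first by rewrite orbT.
  by rewrite leq_exp2r // leq_expn_self ?orbT.
have {}bP := bitsize_leW cX bP; have {}br := bitsize_leW cX br.
have PhiC : 2 ^+ Phi <= 2 `^ ((M * A.+1 ^ 2 * 2 ^ ((e + 2) * 2))%:R
    * (T%:R + l) ^+ ((e + 2) * 2) + (M * A.+1 ^ 2 * 2 ^ ((e + 2) * 2))%:R) :> R.
  apply: le_trans (exp2_le_powR M A T (Y := Y) (e := e + 2) l0 _ _).
  - by rewrite ler_eXn2l ?ltr1n.
  - by rewrite -natr1 lerD2r.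
  - by rewrite addn2.
have rX := norm1_bitsize_le br (mem_head r [::]).
have cardN : (#|{: 'X_{1..n < (2 * d).+1}}| <= N)%N.
  exact: leq_trans (card_bmultinom_le n (2 * d)) (count_exponent_le n d).
have cardN1 : (#|{: 'X_{1..n < d.+1}}| <= N)%N.
  apply: leq_trans (card_bmultinom_le n d) (leq_trans _ (count_exponent_le n d)).
  by rewrite leq_pexp2l // mul2n -addnn leq_addr.
have N0 : (0 < N)%N by rewrite /N muln_gt0 !expn_gt0.
have [g [cg gN dg Ig]] := bounded_sum_of_squares hk dP rX cardN1 sos.
have dr := sos_proof_deg_le sos.
have [sk _ _] := hk.
have epsY : eps <= 2 ^+ Y.
  by apply: le_exp2_lg => //; rewrite -normrN -lgV // ltW.
have epsVY : eps^-1 <= 2 ^+ Y by apply: le_exp2_lg; rewrite ?invr_gt0 // ltW.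
have rgF : norm1 (r - g) <= 2 ^+ (squares_exponent kappa d N X).+1.
  apply: le_trans (norm1B _ _) (le_trans (lerD rX gN) _); apply: exp2D_le => //.
  by rewrite ltnS /squares_exponent; clear; lia.
have ci := certificate_ideal sk dP GB GL cardN N0 Ig (deg_leB dr dg) rgF eps0 epsY epsVY.
have : certificate P ((4 + 2 * b + 2 * kappa) * d) (2 ^+ Phi) (r + eps%:MP).
  have -> : r + eps%:MP = g + (r - g + eps%:MP) by ring.
  apply: certificateW (certificateD (certificateW _ (lexx _) cg) ci).
  - by clear -d0; nia.
  - by apply: exp2D_le; rewrite /Phi // ltnS /ideal_exponent; clear; nia.
  - by clear; nia.
move=> [_ [s' [h' [sos' s'K h'K]]]]; exists s', h'; split=> // q qin.
apply: le_trans (mnorm_le_norm1 q) (le_trans _ PhiC).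
have Phi1 : (1 : R) <= 2 ^+ Phi by rewrite exprn_ege1 ?ler1n.
move: qin; rewrite !mem_cat => /or3P[/s'K q2|/codomP[i ->]|qP].
(* Certificates bound the square of the norm, which bounds the norm itself only above 1. *)
- have [q1|/ltW q1] := leP (norm1 q) 1; first exact: le_trans Phi1.
  by apply: le_trans q2; rewrite expr2 ler_peMr ?norm1_ge0.
- exact: h'K.
- by apply: le_trans (norm1_bitsize_le bP qP) _; rewrite ler_eXn2l ?ltr1n.
Qed.
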